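(* For $p>0$ let $K_p$ be the positive definite kernel on the open unit disc $\mathbb D$ given by $$K_p(z,w)=\sum_{k=0}^\infty (k+1)^p(z\bar w)^k\qquad (z,w\in\mathbb D).$$ Then, for $p>0$, the multiplication operator $M_z$ on $\mathcal H(K_p+K_{p+2})$ is subnormal if and only if $p\geq 1$.
   Context: $\mathbb D=\{z\in\mathbb C:|z|<1\}$. For a positive definite kernel $K$ on $\mathbb D$ (holomorphic in the first variable and anti-holomorphic in the second), $\mathcal H(K)$ denotes the reproducing kernel Hilbert space of holomorphic functions on $\mathbb D$ with reproducing kernel $K$, and $M_z$ denotes the operator of multiplication by the coordinate function, $(M_zf)(z)=zf(z)$. A bounded operator $T$ on a Hilbert space $\mathcal H$ is subnormal if there are a Hilbert space $\mathcal K\supset\mathcal H$ and a bounded normal operator $N$ on $\mathcal K$ with $N(\mathcal H)\subset\mathcal H$ and $N|_{\mathcal H}=T$. *)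

(* Defs.v *)
From mathcomp Require Import all_boot all_order all_algebra.
From mathcomp Require Import sesquilinear complex.
From mathcomp Require Import all_classical all_reals all_analysis.

Set Implicit Arguments.
Unset Strict Implicit.
Unset Printing Implicit Defensive.

Import Order.TTheory GRing.Theory Num.Theory.
Import numFieldNormedType.Exports.

Local Open Scope classical_set_scope.
Local Open Scope ring_scope.
Local Open Scope complex_scope.

(* Over R[i], norms take values in the nonnegative reals of R[i]. The inner
   product is linear in its first and conjugate-linear in its second argument. *)
Record hilbertSpace (R : realType) := HilbertSpace {
  hilbert_sort :> completeNormedModType R[i];
  inner : {dot hilbert_sort for (@Num.conj R[i])};
  inner_norm : forall x : hilbert_sort, `|x| ^+ 2 = inner x x
}.

Section Operators.
Context {R : realType}.

Definition bounded_operator (H L : hilbertSpace R) (T : {linear H -> L}) :=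
  exists M : R, forall x : H, `|T x| <= M%:C * `|x|.

Definition is_adjoint (H : hilbertSpace R) (T S : {linear H -> H}) :=
  forall x y : H, inner H (T x) y = inner H x (S y).

Definition normal_operator (H : hilbertSpace R) (N : {linear H -> H}) :=
  exists S : {linear H -> H}, [/\ bounded_operator S, is_adjoint N S &
    forall x : H, N (S x) = S (N x)].

(* The inclusion of H in a larger Hilbert space L is a linear map J : H -> L
   preserving inner products. *)
Definition subnormal (H : hilbertSpace R) (T : {linear H -> H}) :=
  bounded_operator T /\
  exists (L : hilbertSpace R) (J : {linear H -> L}) (N : {linear L -> L}),
    [/\ isometry (inner L) (inner H) J,
        bounded_operator N,
        normal_operator N &
        forall x : H, N (J x) = J (T x)].

End Operators.

Definition unit_disc (R : realType) : set R[i] := [set z | `|z| < 1].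

Definition holomorphic_on (R : realType) (D : set R[i]) (f : R[i] -> R[i]) :=
  forall z, D z -> derivable (f : R[i]^o -> R[i]^o) z 1.

(* A function on the disc is given as a function on R[i] whose values off the
   disc are irrelevant. An element f of the space is identified with the
   function rkhs_eval f; by rkhs_separated this identification is injective. *)
Record rkhs (R : realType) (K : R[i] -> R[i] -> R[i]) := RKHS {
  rkhs_space :> hilbertSpace R;
  rkhs_eval : rkhs_space -> R[i] -> R[i];
  rkhs_linear : forall (a : R[i]) (f g : rkhs_space) (z : R[i]),
    unit_disc z -> rkhs_eval (a *: f + g) z = a * rkhs_eval f z + rkhs_eval g z;
  rkhs_separated : forall f g : rkhs_space,
    (forall z, unit_disc z -> rkhs_eval f z = rkhs_eval g z) -> f = g;
  rkhs_holomorphic : forall f : rkhs_space,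
    holomorphic_on (@unit_disc R) (rkhs_eval f);
  rkhs_reproducing : forall w, unit_disc w -> exists kw : rkhs_space,
    (forall z, unit_disc z -> rkhs_eval kw z = K z w) /\
    (forall f : rkhs_space, rkhs_eval f w = inner rkhs_space f kw)
}.

Definition is_mul_z (R : realType) (K : R[i] -> R[i] -> R[i]) (H : rkhs K)
    (M : {linear H -> H}) :=
  forall (f : H) (z : R[i]), unit_disc z ->
    rkhs_eval (M f) z = z * rkhs_eval f z.

Definition Kp (R : realType) (p : R) (z w : R[i]) : R[i] :=
  limn (series (fun k : nat => (k.+1%:R `^ p)%:C * (z * w^*) ^+ k) : nat -> R[i]^o).

(* Main.v *)
(* Taylor coefficients at 0 exhibit the monomials as an orthogonal basis of H with
   ||z^n||^2 = m_n = 1 / (x^p (1 + x^2)), x = n + 1, so M_z is a weighted shift.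

   If p >= 1, then m_n = x^(1-p) / (x (1 + x^2)) is a Stieltjes moment sequence:
   1 / (x (1 + x^2)) is the Laplace transform of 1 - cos t, which makes it a
   positive definite kernel in x = l_i + l_j, and so is x^(-s), s >= 0, which for
   s < 1 is a limit of positive combinations of the functions 1 / (x + u). The
   orthogonal polynomials of the symmetrized functional give a symmetric Jacobi
   matrix A with <A^(2n) d_0, d_0> = m_n / m_0. If U is the bilateral shift, then
   U (x) A is normal, and it restricts to M_z on the span of the vectors
   (U (x) A)^n (d_0 (x) d_0). Since all these spaces are separable, U (x) A can be
   realized on H itself.

   If M_z is subnormal with normal extension N, then the n-th differences of m
   are y_n = <(1 - N^*N)^n 1, 1> >= 0. They are the coefficients of the Newton
   series of F(x) = x^(-p) / (1 + x^2). The Newton coefficients satisfy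
   |theta_n(e + i)| <= C theta_n(e), so y >= 0 gives |F(e + i)| <= C F(e), i.e.
   |(e + i)^(-p)| <= C' e e^(-p), which fails for p < 1 as e -> 0. *)
From HB Require Import structures.
Require Import Defs.
From mathcomp Require Import all_boot all_order all_algebra.
From mathcomp Require Import sesquilinear complex.
From mathcomp Require Import all_classical all_reals all_analysis.
From mathcomp Require Import ring lra.
Import Order.TTheory GRing.Theory Num.Theory.
Import numFieldNormedType.Exports.
Set Implicit Arguments.
Unset Strict Implicit.
Unset Printing Implicit Defensive.
Local Open Scope classical_set_scope.
Local Open Scope complex_scope.
Local Open Scope ring_scope.

(** * Stieltjes functions *)

(** The threshold p = 1 compares singularities on the line Re z = 0. F(z) = z^(-p) / (1 + z^2) has
    simple poles at i and -i and grows like e^(-p) at 0. Nonnegative Newton coefficients act as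
    nonnegative power series coefficients do in Pringsheim's theorem: a singularity off the real
    axis cannot be stronger than the one at the real point of the same line, so a simple pole at i
    forces p >= 1. The estimates run on partial sums. Multiplication by x becomes summation by
    parts, and two such steps pass from F to (1 + x^2) F = x^(-p), at the price of boundary terms
    that must be shown to vanish. The value (e + i)^(-p) is represented by the imaginary part of a
    partial Newton sum of x^(-p), which is a Stieltjes function exactly in the range 0 < p < 1 under
    attack. Stieltjes functions are handled as the closed cone generated by the 1 / (x + u), in both
    directions of the theorem: there the Newton sums are explicit, and 1 / (l_i + l_j + u) is a
    Cauchy kernel. Contractivity is always obtained from boundedness: neither multiplication by X
    for the moment functional nor the normal extension N is a contraction at the outset, but
    log-convex bounded sequences cannot increase. *)

Section StieltjesCone.
Variable R : realType.
Implicit Types (f g : R -> R) (s x q : R).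

(* Only the values on (0, +oo) matter. *)
Inductive stieltjes : (R -> R) -> Prop :=
| stieltjes_inv u : 0 <= u -> stieltjes (fun x => (x + u)^-1)
| stieltjes_add f g :
    stieltjes f -> stieltjes g -> stieltjes (fun x => f x + g x)
| stieltjes_scale c f : 0 <= c -> stieltjes f -> stieltjes (fun x => c * f x)
| stieltjes_lim (F : nat -> R -> R) f : (forall n, stieltjes (F n)) ->
    (forall x, 0 < x -> F n x @[n --> \oo] --> f x) -> stieltjes f.

Lemma stieltjes_ext f g :
  stieltjes f -> (forall x, 0 < x -> f x = g x) -> stieltjes g.
Proof.
move=> Sf fg; apply: (stieltjes_lim (F := fun=> f)) => // x x0.
by rewrite -fg//; exact: cvg_cst.
Qed.

Lemma stieltjes_sum (I : Type) (r : seq I) (F : I -> R -> R) :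
  (forall i, stieltjes (F i)) -> stieltjes (fun x => \sum_(i <- r) F i x).
Proof.
move=> SF; elim: r => [|i r IH].
  apply: (@stieltjes_ext (fun x => 0 * (x + 0)^-1)).
    by apply: stieltjes_scale => //; exact: stieltjes_inv.
  by move=> x _; rewrite mul0r big_nil.
apply: (@stieltjes_ext (fun x => F i x + \sum_(j <- r) F j x)).
  exact: stieltjes_add.
by move=> x _; rewrite big_cons.
Qed.

(** * Negative powers as limits of geometric sums *)

Section LogPeriodic.
Variables (s q : R).
Hypotheses (s0 : 0 < s) (s1 : s < 1) (q0 : 0 < q) (q1 : q < 1).

Let a := q `^ s.
Let b := q `^ (1 - s).

Let powR1l (r : R) : 1 `^ r = 1. Proof. by rewrite powR1. Qed.
Let a0 : 0 < a. Proof. exact: powR_gt0. Qed.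
Let b0 : 0 < b. Proof. exact: powR_gt0. Qed.
Let a1 : a < 1.
Proof. by rewrite -[ltRHS](powR1l s); apply: gt0_ltr_powR => //; rewrite nnegrE ?ltW. Qed.
Let b1 : b < 1.
Proof.
rewrite -[ltRHS](powR1l (1 - s)); apply: gt0_ltr_powR; rewrite ?nnegrE ?ltW//.
by rewrite subr_gt0.
Qed.
Let ab : a * b = q.
Proof.
rewrite /a /b -powRD; last by rewrite (gt_eqF q0) implybT.
by rewrite addrC subrK powRr1// ltW.
Qed.
Let aq : q <= a.
Proof. by rewrite -ab ger_pMr// ltW. Qed.

(** For u = q^m, the sum of u^(1-s) / (x + u) over all integers m is a Riemann sum in ln u of the
    integral of u^(-s) / (x + u) du, a multiple of x^(-s). [F2] collects the m = k + 1, and [F1] the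
    m = -k, with numerator and denominator multiplied by q^k. *)
Let F1 K x := \sum_(k < K) a ^+ k / (1 + x * q ^+ k).
Let F2 K x := \sum_(k < K) b ^+ k.+1 / (x + q ^+ k.+1).

Let den1 x k : 0 < x -> 0 < 1 + x * q ^+ k.
Proof. by move=> x0; rewrite addr_gt0// mulr_gt0// exprn_gt0. Qed.
Let den2 x k : 0 < x -> 0 < x + q ^+ k.
Proof. by move=> x0; rewrite addr_gt0// exprn_gt0. Qed.

Let cvgF1 x : 0 < x -> cvgn (F1 ^~ x).
Proof.
move=> x0.
have -> : F1 ^~ x = series (fun k => a ^+ k / (1 + x * q ^+ k)).
  by apply/funext => K; rewrite /F1 /series/= big_mkord.
apply: (@series_le_cvg _ _ (geometric 1 a)).
- by move=> n; rewrite divr_ge0// ?exprn_ge0// ltW// den1.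
- by move=> n; rewrite /= mul1r exprn_ge0// ltW.
- move=> n; rewrite /= mul1r ler_pdivrMr ?den1// ler_peMr ?exprn_ge0 ?ltW//.
  by rewrite ltrDl mulr_gt0// exprn_gt0.
- by apply: is_cvg_geometric_series; rewrite gtr0_norm.
Qed.

Let cvgF2 x : 0 < x -> cvgn (F2 ^~ x).
Proof.
move=> x0.
have -> : F2 ^~ x = series (fun k => b ^+ k.+1 / (x + q ^+ k.+1)).
  by apply/funext => K; rewrite /F2 /series/= big_mkord.
apply: (@series_le_cvg _ _ (geometric (b / x) b)).
- by move=> n; rewrite divr_ge0// ?exprn_ge0// ltW// den2.
- by move=> n; rewrite /= mulr_ge0 ?divr_ge0 ?exprn_ge0// ltW.
- move=> n; rewrite /= [leRHS]mulrAC -exprS ler_pM2l ?exprn_gt0//.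
  by rewrite lef_pV2 ?posrE ?den2// lerDl ltW// exprn_gt0.
- by apply: is_cvg_geometric_series; rewrite gtr0_norm.
Qed.

(* S (x / q) = q ^ s S x, so S x * x ^ s is periodic in ln x with period - ln q,
   hence nearly constant when q is close to 1. *)
Definition log_periodic x : R := limn (F1 ^~ x) + limn (F2 ^~ x).
Let S := log_periodic.

Let cvgS x : 0 < x -> F1 K x + F2 K x @[K --> \oo] --> S x.
Proof. by move=> x0; apply: cvgD; [exact: cvgF1 | exact: cvgF2]. Qed.

Lemma stieltjes_log_periodic : stieltjes log_periodic.
Proof.
apply: (stieltjes_lim (F := fun K x => F1 K x + F2 K x)); last exact: cvgS.
move=> K; apply: stieltjes_add; apply: stieltjes_sum => k.
  apply: (@stieltjes_ext (fun x => (a ^+ k / q ^+ k) * (x + (q ^+ k)^-1)^-1)).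
    apply: stieltjes_scale; first by rewrite divr_ge0// exprn_ge0// ltW.
    by apply: stieltjes_inv; rewrite invr_ge0 exprn_ge0// ltW.
  move=> x x0; have := den1 k x0; have qk : 0 < q ^+ k by rewrite exprn_gt0.
  move=> h; rewrite -mulrA -invfM mulrDr mulfV ?gt_eqF//.
  by rewrite addrC mulrC [q ^+ k * x]mulrC mulrC.
apply: stieltjes_scale; first by rewrite exprn_ge0// ltW.
by apply: stieltjes_inv; rewrite exprn_ge0// ltW.
Qed.

(** Passing from x to x / q moves the index m by one, so a single term crosses from [F1] to [F2].
    The partial sums agree exactly once K + 1 terms of [F1] are taken on the left and K + 1 terms of
    [F2] on the right. *)
Let scaleS x : 0 < x -> S (x / q) = a * S x.
Proof.
move=> x0; have xq0 : 0 < x / q by rewrite divr_gt0.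
have shift (u : R^nat) (l : R) : u n @[n --> \oo] --> l -> u n.+1 @[n --> \oo] --> l.
  by move=> h; rewrite (cvg_shiftS u).
have c1 : F1 K.+1 (x / q) + F2 K (x / q) @[K --> \oo] --> S (x / q).
  by apply: cvgD; [exact: (shift _ _ (cvgF1 xq0)) | exact: cvgF2].
have c2 : a * (F1 K x + F2 K.+1 x) @[K --> \oo] --> a * S x.
  by apply: cvgMl_tmp; apply: cvgD; [exact: cvgF1 | exact: (shift _ _ (cvgF2 x0))].
suff E : (fun K => F1 K.+1 (x / q) + F2 K (x / q)) =
    (fun K => a * (F1 K x + F2 K.+1 x)).
  by rewrite E in c1; exact: (cvg_unique _ c1 c2).
apply/funext => K; rewrite /F1 /F2 !big_ord_recl !mulrDr !expr0 !expr1 mulr1 div1r.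
rewrite addrAC [RHS]addrCA.
have -> : (1 + x / q)^-1 = a * (b / (x + q)).
  rewrite mulrA ab -[X in _ = X / _]invrK -invfM mulrDr mulVf ?gt_eqF// addrC.
  by rewrite [_ * x]mulrC.
rewrite -!addrA; congr (_ + _); rewrite addrC; congr (_ + _).
  rewrite mulr_sumr; apply: eq_bigr => k _; rewrite !lift0.
  by rewrite [a ^+ k.+1]exprS [q ^+ k.+1]exprS mulrA mulfVK ?gt_eqF// mulrA.
rewrite mulr_sumr; apply: eq_bigr => k _; rewrite !lift0.
rewrite mulrA [b ^+ k.+2]exprS [a * _]mulrA ab exprSr.
have -> : x / q + q ^+ k.+1 = (x + q ^+ k.+2) / q.
  by rewrite mulrDl [q ^+ k.+2]exprSr mulfK// gt_eqF.
by rewrite invf_div -exprSr mulrA [q * _]mulrC.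
Qed.

Let leS x y : 0 < x -> x <= y -> S y <= S x.
Proof.
move=> x0 xy; have y0 := lt_le_trans x0 xy.
apply: (ler_cvg_to (cvgS y0) (cvgS x0)); apply: nearW => K.
apply: lerD; apply: ler_sum => k _; rewrite ler_pM2l ?exprn_gt0//.
  by rewrite lef_pV2 ?posrE ?den1// lerD2l ler_pM2r// exprn_gt0.
by rewrite lef_pV2 ?posrE ?den2// lerD2r.
Qed.

Lemma log_periodic1_gt0 : 0 < log_periodic 1.
Proof.
rewrite -/(S 1); have h : 2^-1 <= S 1.
  apply: (cvgr_to_ge (cvgS ltr01)); exists 1%N => // K /= K1.
  case: K K1 => // K _; rewrite /F1 big_ord_recl expr0 mulr1 div1r.
  rewrite -addrA lerDl addr_ge0// sumr_ge0// => k _.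
    by rewrite divr_ge0 ?exprn_ge0 ?ltW// den1.
  by rewrite divr_ge0 ?exprn_ge0 ?ltW// den2.
by apply: lt_le_trans h; rewrite invr_gt0.
Qed.

Let T x := S x * x `^ s.

Let scaleT x : 0 < x -> T (x * q) = T x.
Proof.
move=> x0; have xq0 : 0 < x * q by rewrite mulr_gt0.
have -> : x = (x * q) / q by rewrite mulfK// gt_eqF.
rewrite [in RHS]/T scaleS// [in LHS]mulfK ?gt_eqF// /T.
have -> : (x * q / q) `^ s = (x * q) `^ s / a.
  rewrite [(x * q / q) `^ s]powRM ?ltW ?invr_gt0//; congr (_ * _).
  by rewrite -powR_inv1 ?ltW// powRAC powR_inv1// ltW.
by rewrite [a * _]mulrC -mulrA [a * _]mulrCA mulfV ?mulr1// gt_eqF.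
Qed.

(** On [q, 1] the decreasing S lies between S 1 and S q = S 1 / a, and x^s lies between a and 1. As
    q <= a, this gives the bounds there, and the periodicity of [T] carries them to all x > 0. *)
Lemma log_periodic_bounds x : 0 < x ->
  q <= log_periodic x / log_periodic 1 * x `^ s <= q^-1.
Proof.
rewrite mulrAC -/S -/(T x).
suff: forall x, 0 < x -> q * S 1 <= T x <= q^-1 * S 1.
  by move=> h x0; rewrite ler_pdivlMr ?ler_pdivrMr ?h ?log_periodic1_gt0.
have base y : q <= y <= 1 -> q * S 1 <= T y <= q^-1 * S 1.
  move=> /andP[qy y1]; have y0 := lt_le_trans q0 qy.
  have S0 : 0 < S 1 := log_periodic1_gt0.
  have ys1 : y `^ s <= 1.
    by rewrite -[leRHS](powR1l s) ge0_ler_powR ?nnegrE//; exact: ltW.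
  have ysa : a <= y `^ s by rewrite ge0_ler_powR ?nnegrE//; exact: ltW.
  have S1y : S 1 <= S y by exact: leS.
  have Syq : S y <= S 1 / a.
    have := leS q0 qy; rewrite -[X in X <= _]/(S y) => /le_trans; apply.
    have := scaleS q0; rewrite mulfV ?gt_eqF// => ->.
    by rewrite mulrAC mulfV ?mul1r// gt_eqF.
  have Sy0 := lt_le_trans log_periodic1_gt0 S1y.
  apply/andP; split.
    rewrite /T mulrC; apply: ler_pM => //; try exact: ltW.
    exact: le_trans aq ysa.
  apply: (@le_trans _ _ (S y)); first by rewrite /T ger_pMr.
  apply: (le_trans Syq); rewrite mulrC ler_pM2r//.
  by rewrite lef_pV2 ?posrE.
have low n y : q ^+ n <= y <= 1 -> q * S 1 <= T y <= q^-1 * S 1.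
  elim: n y => [|n IH] y /andP[qy y1].
    by apply: base; rewrite y1 (le_trans _ qy)// expr0 ltW.
  have [qley|yltq] := leP q y; first by apply: base; rewrite qley.
  have y0 : 0 < y by rewrite (lt_le_trans _ qy)// exprn_gt0.
  have -> : y = (y / q) * q by rewrite mulfVK// gt_eqF.
  rewrite scaleT ?divr_gt0//; apply: IH.
  by rewrite ler_pdivlMr// ler_pdivrMr// -exprSr qy mul1r ltW.
have high n y : 1 <= y -> y * q ^+ n <= 1 -> q * S 1 <= T y <= q^-1 * S 1.
  elim: n y => [|n IH] y y1 yq.
    by apply: (low 0%N); rewrite expr0 y1; rewrite expr0 mulr1 in yq.
  have y0 := lt_le_trans ltr01 y1.
  rewrite -scaleT//; have [h|h] := leP 1 (y * q).
    by apply: IH => //; rewrite -mulrA -exprS.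
  by apply: base; rewrite (ltW h) andbT ler_peMl// ltW.
move=> {}x x0.
have [n nx] : exists n, q ^+ n <= Num.min x x^-1.
  have m0 : 0 < Num.min x x^-1 by rewrite lt_min x0 invr_gt0.
  have : q ^+ n @[n --> \oo] --> 0 by apply: cvg_expr; rewrite gtr0_norm.
  move/cvgrPdist_le => /(_ _ m0)[n _ /(_ n (leqnn n))]/=.
  by rewrite sub0r normrN gtr0_norm ?exprn_gt0// => h; exists n.
move: nx; rewrite le_min => /andP[n1 n2].
have [x1|x1] := leP x 1; first by apply: (low n); rewrite n1.
by apply: (high n); [exact: ltW | rewrite mulrC -ler_pdivlMr// div1r].
Qed.

End LogPeriodic.

(** The bounds q and 1 / q close up as q tends to 1. Division by the value at 1 stands in for the
    constant pi / sin (pi s) of the integral. *)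
Lemma stieltjes_powRN s : 0 < s -> s < 1 -> stieltjes (fun x => x `^ (- s)).
Proof.
move=> s0 s1.
pose q (n : nat) : R := 1 - harmonic n.+1.
have qE n : q n = 1 - n.+2%:R^-1 by [].
have q0 n : 0 < q n by rewrite qE subr_gt0 invf_lt1 ?ltr1n// ltr0n.
have q1 n : q n < 1 by rewrite qE ltrBlDr ltrDl invr_gt0 ltr0n.
have qcvg : q n @[n --> \oo] --> (1 : R).
  rewrite -[X in _ --> X](subr0 1); apply: cvgB; first exact: cvg_cst.
  by rewrite (cvg_shiftS (@harmonic R)); exact: cvg_harmonic.
pose S n := log_periodic s (q n).
apply: (stieltjes_lim (F := fun n x => (S n 1)^-1 * S n x)).
  move=> n; apply: stieltjes_scale; last exact: stieltjes_log_periodic.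
  by rewrite invr_ge0 ltW// log_periodic1_gt0.
move=> x x0.
have xs0 : 0 < x `^ s by exact: powR_gt0.
apply: (@squeeze_cvgr _ _ _ _ (fun n => q n / x `^ s) (fun n => (q n)^-1 / x `^ s)).
- apply: nearW => n; rewrite ler_pdivrMr// ler_pdivlMr// [_^-1 * _]mulrC.
  exact: log_periodic_bounds.
- rewrite powRN -[X in _ --> X]mul1r; apply: cvgMr_tmp => //.
- have -> : x `^ (- s) = 1^-1 / x `^ s by rewrite powRN invr1 mul1r.
  by apply: cvgMr_tmp; apply: cvgV.
Qed.

End StieltjesCone.

(** * Positive definite kernels *)

Section PositiveKernels.
Variable R : realType.
Notation C := R[i].

Lemma Re_conjC (z : C) : complex.Re z^* = complex.Re z.
Proof. by case: z. Qed.

Lemma Im_conjC (z : C) : complex.Im z^* = - complex.Im z.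
Proof. by case: z. Qed.

Lemma conjC_real (x : R) : (x%:C)^* = x%:C :> C.
Proof. by apply/eqP; rewrite eq_complex /= oppr0 !eqxx. Qed.

Lemma cvgn_sum (I : Type) (r : seq I) (u : I -> nat -> R) (v : I -> R) :
  (forall i, u i n @[n --> \oo] --> v i) ->
  \sum_(i <- r) u i n @[n --> \oo] --> \sum_(i <- r) v i.
Proof.
move=> uv; elim: r => [|i r IH].
  rewrite big_nil (_ : (fun n => _) = fun=> 0); first exact: cvg_cst.
  by apply/funext => n; rewrite big_nil.
rewrite big_cons (_ : (fun n => _) = fun n => u i n + \sum_(j <- r) u j n).
  exact: cvgD.
by apply/funext => n; rewrite big_cons.
Qed.

(** Coefficients travel with their points in a list, repetitions allowed, so that rescaling, moving
    points and dropping the head are list operations. In R[i], [0 <=] also says that the form is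
    real. *)
Definition psd (T : Type) (k : T -> T -> C) := forall s : seq (C * T),
  0 <= \sum_(a <- s) \sum_(b <- s) a.1 * b.1^* * k a.2 b.2.

Variable T : Type.
Implicit Types (k : T -> T -> C).

Lemma eq_psd k k' : k =2 k' -> psd k -> psd k'.
Proof.
move=> kk' pk s; have := pk s; congr (_ <= _).
by apply: eq_bigr => a _; apply: eq_bigr => b _; rewrite kk'.
Qed.

Lemma psd_const1 : psd (fun _ _ : T => 1).
Proof.
move=> s; rewrite (_ : \sum_(a <- s) _ = `|\sum_(a <- s) a.1| ^+ 2).
  by rewrite exprn_ge0.
rewrite normCK rmorph_sum mulr_suml; apply: eq_bigr => a _.
by rewrite mulr_sumr; apply: eq_bigr => b _; rewrite mulr1.
Qed.

Lemma psd_congr k (g : T -> C) : psd k -> psd (fun s t => g s * (g t)^* * k s t).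
Proof.
move=> pk s; have := pk [seq (a.1 * g a.2, a.2) | a <- s].
congr (_ <= _); rewrite big_map; apply: eq_bigr => a _.
rewrite big_map; apply: eq_bigr => b _ /=.
by rewrite rmorphM/=; ring.
Qed.

Lemma psdD k k' : psd k -> psd k' -> psd (fun s t => k s t + k' s t).
Proof.
move=> pk pk' s; have := addr_ge0 (pk s) (pk' s); congr (_ <= _).
rewrite -big_split; apply: eq_bigr => a _ /=.
by rewrite -big_split; apply: eq_bigr => b _ /=; rewrite mulrDr.
Qed.

Lemma psdZ k (c : C) : 0 <= c -> psd k -> psd (fun s t => c * k s t).
Proof.
move=> c0 pk s; have := mulr_ge0 c0 (pk s); congr (_ <= _).
rewrite mulr_sumr; apply: eq_bigr => a _.
by rewrite mulr_sumr; apply: eq_bigr => b _; rewrite mulrCA.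
Qed.

Lemma psd_lim k (F : nat -> T -> T -> R) (f : T -> T -> R) :
  (forall n, psd (fun s t => k s t * (F n s t)%:C)) ->
  (forall s t, F n s t @[n --> \oo] --> f s t) ->
  psd (fun s t => k s t * (f s t)%:C).
Proof.
move=> pF cF s.
(* As [G] is real, the real and imaginary parts of the form are real linear in [G], so the limits
   can be taken in R. *)
pose e (h : C -> R) (G : T -> T -> R) :=
  \sum_(a <- s) \sum_(b <- s) h (a.1 * b.1^* * k a.2 b.2) * G a.2 b.2.
have sumE G : \sum_(a <- s) \sum_(b <- s) a.1 * b.1^* * (k a.2 b.2 * (G a.2 b.2)%:C)
    = Complex (e (@complex.Re R) G) (e (@complex.Im R) G).
  rewrite /e; apply/eqP; rewrite eq_complex /= !raddf_sum /=; apply/andP; split.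
    apply/eqP; apply: eq_bigr => a _; rewrite raddf_sum /=; apply: eq_bigr => b _.
    by rewrite mulrA; case: (_ * k _ _) => x y /=; rewrite mulr0 subr0.
  apply/eqP; apply: eq_bigr => a _; rewrite raddf_sum /=; apply: eq_bigr => b _.
  by rewrite mulrA; case: (_ * k _ _) => x y /=; rewrite mulr0 add0r.
have ce h : e h (F n) @[n --> \oo] --> e h f.
  apply: cvgn_sum => a; apply: cvgn_sum => b.
  by apply: cvgMl_tmp; exact: cF.
have eF n : e (@complex.Im R) (F n) = 0 /\ 0 <= e (@complex.Re R) (F n).
  by have := pF n s; rewrite sumE lecE/= => /andP[/eqP].
rewrite sumE lecE /=; apply/andP; split.
  apply/eqP; apply: (cvg_unique _ (ce _)) => //.
  rewrite (_ : (fun n => e (@complex.Im R) (F n)) = fun=> 0); first exact: cvg_cst.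
  by apply/funext => n; case: (eF n).
by apply: (cvgr_to_ge (ce _)); apply: nearW => n; case: (eF n).
Qed.

(* The Cauchy kernel minus a rank-one kernel is b(z) (b w)^* times the Cauchy
   kernel, where b is the Blaschke factor vanishing at the head of the list. *)
Lemma psd_cauchy k (z : T -> C) : (forall t, 0 < complex.Re (z t)) -> psd k ->
  psd (fun s t => k s t / (z s + (z t)^*)).
Proof.
move=> z0 pk s; have [n] := ubnP (size s); elim: n s => // n IH [_|[c0 t0] s].
  by rewrite big_nil.
rewrite /= ltnS => sn.
have zz u v : z u + (z v)^* != 0.
  apply/negP => /eqP /(congr1 (@complex.Re R)); rewrite raddfD /= Re_conjC => /eqP.
  by rewrite gt_eqF ?addr_gt0.
pose b t := (z t - z t0) / (z t + (z t0)^*).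
pose E t := (z t + (z t0)^*)^-1.
pose c := z t0 + (z t0)^*.
have c_ge0 : 0 <= c.
  rewrite lecE !raddfD /= Im_conjC Re_conjC subrr eqxx /=.
  by rewrite addr_ge0// ltW.
have keyE u v : k u v / (z u + (z v)^*) = c * (E u * (E v)^* * k u v) +
    b u * (b v)^* * (k u v / (z u + (z v)^*)).
  have h1 := zz u v; have h2 := zz u t0; have h3 : (z v)^* + z t0 != 0.
    by rewrite addrC zz.
  rewrite /b /E /c !(rmorphM, rmorphB, fmorphV, rmorphD)/= !conjCK.
  by field; rewrite h1 h2 h3.
set s' := (c0, t0) :: s.
have -> : \sum_(x <- s') \sum_(y <- s') x.1 * y.1^* * (k x.2 y.2 / (z x.2 + (z y.2)^*)) =
  \sum_(x <- s') \sum_(y <- s') x.1 * y.1^* * (c * (E x.2 * (E y.2)^* * k x.2 y.2)) +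
  \sum_(x <- [seq (x.1 * b x.2, x.2) | x <- s])
  \sum_(y <- [seq (x.1 * b x.2, x.2) | x <- s]) x.1 * y.1^* * (k x.2 y.2 / (z x.2 + (z y.2)^*)).
  rewrite [X in _ + X](_ : _ = \sum_(x <- s') \sum_(y <- s') (x.1 * b x.2) *
    (y.1 * b y.2)^* * (k x.2 y.2 / (z x.2 + (z y.2)^*))).
    rewrite -big_split; apply: eq_bigr => x _ /=; rewrite -big_split.
    apply: eq_bigr => y _ /=; rewrite [in LHS]keyE mulrDr; congr (_ + _).
    by rewrite [(_ * b _)^*]rmorphM; set K := _ / _; ring.
  have b0 : b t0 = 0 by rewrite /b subrr mul0r.
  rewrite /s' big_cons [X in X + _]big1 => [|y _]; last first.
    by rewrite /= b0 mulr0 !mul0r.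
  rewrite add0r big_map; apply: eq_bigr => x _.
  by rewrite big_cons /= b0 mulr0 rmorph0 mulr0 mul0r add0r big_map.
apply: addr_ge0; last by apply: IH; rewrite size_map.
by apply: (psdZ c_ge0 (psd_congr E pk)).
Qed.

(** This is the form of [k] on the doubled list that puts each coefficient a at [g] and -a at
    [h]. *)
Lemma psd_diff (U : Type) (k : U -> U -> C) (g h : T -> U) : psd k ->
  psd (fun s t => k (g s) (g t) - k (g s) (h t) - k (h s) (g t) + k (h s) (h t)).
Proof.
move=> pk s; have := pk ([seq (a.1, g a.2) | a <- s] ++ [seq (- a.1, h a.2) | a <- s]).
congr (_ <= _); rewrite big_cat /= !big_map -big_split; apply: eq_bigr => a _ /=.
rewrite !big_cat /= !big_map -!big_split; apply: eq_bigr => b _ /=.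
by rewrite rmorphN; ring.
Qed.

End PositiveKernels.

(** * Laplace transforms and powers as positive definite kernels *)

Section LaplaceKernels.
Variables (R : realType) (T : Type) (l : T -> R).
Hypothesis l0 : forall t, 0 < l t.
Notation C := R[i].

(* The Laplace transform of 1 - cos t, which is half of |1 - exp (i t)| ^ 2. *)
Lemma psd_laplace_1Bcos :
  psd (fun s t => (((l s + l t) * (1 + (l s + l t) ^+ 2))^-1)%:C).
Proof.
(* The points l + i/2 and l - i/2 produce the sums x, x + i and x - i with x = l s + l t. Half of
   the resulting second difference of the Cauchy kernel is 1 / x - x / (1 + x^2). *)
pose z (tb : T * bool) : C := Complex (l tb.1) (if tb.2 then 2^-1 else - 2^-1).
have pz : psd (fun s t => 1 / (z s + (z t)^*)).
  by apply: (psd_cauchy (z := z)); [case=> t b; exact: l0 | exact: psd_const1].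
have := psdZ _ (psd_diff (fun t => (t, true)) (fun t => (t, false)) pz).
move=> /(_ (2^-1)); rewrite invr_ge0 ler0n => /(_ isT).
apply: eq_psd => s t; set x := l s + l t.
have x0 : x != 0 by rewrite gt_eqF// addr_gt0.
have xC0 : x%:C != 0 :> C by rewrite (fmorph_eq0 (real_complex R)).
pose P : C := Complex x 1; pose M : C := Complex x (- 1).
have PM : P * M = 1 + x%:C ^+ 2.
  by rewrite /P /M expr2; apply/eqP; rewrite eq_complex /=; apply/andP; split;
     apply/eqP; ring.
have PDM : P + M = 2 * x%:C.
  by rewrite /P /M mulrDl mul1r; apply/eqP; rewrite eq_complex /= subrr addr0 !eqxx.
have PM0 : P * M != 0.
  rewrite PM; apply/negP => /eqP/(congr1 (@complex.Re R)) /=.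
  by rewrite mul0r subr0 -expr2 => /eqP; rewrite gt_eqF// ltr_wpDr ?sqr_ge0.
have [P0 M0] : P != 0 /\ M != 0.
  by move: PM0; rewrite mulf_eq0 negb_or => /andP.
have zE b b' : z (s, b) + (z (t, b'))^* =
    if b == b' then x%:C else if b then P else M.
  apply/eqP; rewrite eq_complex /=; case: b; case: b' => /=; rewrite eqxx /=;
  apply/eqP; lra.
move: zE; clearbody x => zE.
have -> : ((x * (1 + x ^+ 2))^-1)%:C = (x%:C * (P * M))^-1 :> C.
  by rewrite PM (fmorphV (real_complex R)) (rmorphM (real_complex R))
    (rmorphD (real_complex R)) (rmorphXn (real_complex R)).
rewrite !zE /=.
have h : 1 / P + 1 / M = 2 * x%:C / (P * M).
  by rewrite -PDM; field; rewrite P0 M0.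
transitivity (1 / x%:C - 2^-1 * (1 / P + 1 / M)); first by field; rewrite P0 M0 xC0.
rewrite h.
have -> : 1 / x%:C - 2^-1 * (2 * x%:C / (P * M)) = (P * M - x%:C ^+ 2) / (x%:C * (P * M)).
  by field; rewrite P0 M0 xC0.
by rewrite {1}PM addrK div1r.
Qed.

(** On a generator, u is shared evenly as u/2 + u/2, which makes 1 / (l s + l t + u) a Cauchy
    kernel; sums, multiples and limits preserve positivity. *)
Lemma psd_stieltjes (k : T -> T -> C) (f : R -> R) : psd k -> stieltjes f ->
  psd (fun s t => k s t * (f (l s + l t))%:C).
Proof.
move=> pk; elim=> {f} [u u0|f g _ pf _ pg|c f c0 _ pf|F f _ pF cF].
- pose z t : C := (l t + u / 2)%:C.
  apply: (eq_psd _ (psd_cauchy (z := z) _ pk)).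
    move=> s t; rewrite (fmorphV (real_complex R)); congr (_ / _).
    by apply/eqP; rewrite eq_complex /= oppr0 addr0 eqxx andbT; apply/eqP; field.
  by move=> t; rewrite /z /= ltr_wpDr// divr_ge0.
- by apply: eq_psd (psdD pf pg) => s t; rewrite rmorphD mulrDr.
- have cC0 : 0 <= c%:C by rewrite ler0c.
  by apply: eq_psd (psdZ cC0 pf) => s t; rewrite rmorphM mulrCA.
- apply: (psd_lim pF) => s t; apply: cF; exact: addr_gt0.
Qed.

Lemma psd_powRN (k : T -> T -> C) (r : R) : 0 <= r -> psd k ->
  psd (fun s t => k s t * ((l s + l t) `^ (- r))%:C).
Proof.
move=> r0 pk.
(* Only exponents below 1 come from Stieltjes functions, so r is cut into N equal parts e < 1 and
   the kernel is multiplied N times. *)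
pose N := (Num.truncn r).+1; pose e := r / N%:R.
have e0 : 0 <= e by rewrite divr_ge0.
have e1 : e < 1 by rewrite ltr_pdivrMr ?ltr0n// mul1r truncnS_gt.
have step k' : psd k' -> psd (fun s t => k' s t * ((l s + l t) `^ (- e))%:C).
  move=> pk'; move: e0; rewrite le_eqVlt => /predU1P[<-|e_gt0].
    by apply: eq_psd pk' => s t; rewrite oppr0 powRr0 mulr1.
  by exact: (psd_stieltjes pk' (stieltjes_powRN e_gt0 e1)).
have iter_step n : psd (fun s t => k s t * ((l s + l t) `^ (- (e * n%:R)))%:C).
  elim: n => [|n IH].
    by apply: eq_psd pk => s t; rewrite mulr0 oppr0 powRr0 mulr1.
  apply: eq_psd (step _ IH) => s t; rewrite -mulrA -(rmorphM (real_complex R)) -powRD.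
    by rewrite -opprD -[in RHS]natr1 mulrDr mulr1.
  by rewrite (gt_eqF (addr_gt0 (l0 s) (l0 t))) implybT.
by have := iter_step N; rewrite /e divfK// pnatr_eq0.
Qed.

End LaplaceKernels.

(** * The moments and their symmetrization *)

Section Moments.
Variables (R : realType) (p : R).
Implicit Types n : nat.

Definition kcoef n : R := n.+1%:R `^ p + n.+1%:R `^ (p + 2).
Definition moment n : R := (kcoef n)^-1.

(* The moments of a symmetric measure on [-1, 1] whose image under squaring has
   moments [moment]. *)
Definition sym_moment n : R := if odd n then 0 else moment n./2.

Lemma kcoefE n : kcoef n = n.+1%:R `^ p * (1 + n.+1%:R ^+ 2).
Proof.
by rewrite /kcoef mulrDr mulr1 powRD ?pnatr_eq0 ?implybT// powR_mulrn.
Qed.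

Lemma kcoef_gt0 n : 0 < kcoef n.
Proof.
by rewrite kcoefE mulr_gt0 ?powR_gt0 ?ltr0n// ltr_wpDr// sqr_ge0.
Qed.

Lemma moment_gt0 n : 0 < moment n.
Proof. by rewrite invr_gt0 kcoef_gt0. Qed.

(* The shift l_i = (i + 1) / 2 makes l_i + l_j = n + 1 when i + j = 2 n; odd i + j
   are killed by the kernel (1 + (-1) ^ (i + j)) / 2. *)
Lemma sym_moment_psd (c : nat -> R) N : 1 <= p ->
  0 <= \sum_(i < N) \sum_(j < N) c i * c j * sym_moment (i + j).
Proof.
move=> p1; pose l (n : nat) : R := n.+1%:R / 2.
have l0 n : 0 < l n by rewrite divr_gt0.
have p0 : 0 <= p - 1 by rewrite subr_ge0.
have K0 := psd_powRN l0 p0 (psd_laplace_1Bcos l0).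
pose sg n : R[i] := ((-1) ^+ n)%:C.
have sgE i j : 1 + sg i * (sg j)^* = (2 * (~~ odd (i + j))%:R)%:C.
  rewrite /sg conjC_real -(rmorphM (real_complex R)) -exprD -signr_odd.
  by case: odd; apply/eqP; rewrite eq_complex /= addr0 eqxx andbT; apply/eqP => /=; lra.
have half0 : (0 : R[i]) <= 2^-1 by rewrite invr_ge0.
have K1 := psdZ half0 (psdD K0 (psd_congr sg K0)).
have K2 : psd (fun i j => (sym_moment (i + j))%:C).
  apply: eq_psd K1 => i j; set AB := (_%:C * _).
  have -> : AB + sg i * (sg j)^* * AB = (1 + sg i * (sg j)^*) * AB.
    by rewrite mulrDl mul1r.
  have -> : 2^-1 = (2^-1)%:C :> R[i].
    by rewrite (fmorphV (real_complex R)) (rmorph_nat (real_complex R)).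
  rewrite sgE /AB -!(rmorphM (real_complex R)); congr (_%:C).
  rewrite mulrA [2^-1 * _]mulrA mulVf ?pnatr_eq0// mul1r /sym_moment.
  have [|ev] := boolP (odd _); first by rewrite mul0r.
  have -> : l i + l j = (i + j)./2.+1%:R.
    rewrite /l -mulrDl -natrD addSn addnS.
    have -> : (i + j).+2 = ((i + j)./2.+1 * 2)%N by rewrite muln2 doubleS even_halfK.
    by rewrite natrM mulfK ?pnatr_eq0.
  set x := _.+1%:R; rewrite mul1r /moment kcoefE -/x.
  have x0 : 0 < x by rewrite ltr0n.
  have -> : x `^ p = x * x `^ (p - 1).
    rewrite -[X in X * _](@powRr1 _ x) ?ltW// -powRD ?(gt_eqF x0) ?implybT//.
    by rewrite addrC subrK.
  rewrite powRN !invfM; ring.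
have := K2 [seq ((c (nat_of_ord i))%:C, nat_of_ord i) | i : 'I_N <- enum 'I_N].
rewrite big_map big_enum -ler0c (rmorph_sum (real_complex R)) /=.
congr (_ <= _); apply: eq_bigr => i _.
rewrite (rmorph_sum (real_complex R)) big_map big_enum; apply: eq_bigr => j _ /=.
by rewrite conjC_real -!(rmorphM (real_complex R)).
Qed.
End Moments.

(** * Jacobi matrix of a symmetric moment functional *)

Section JacobiCoefficients.
Variable R : realType.

(** The case D = 0 must be included, since the moment functional may have null vectors; there an
    affine function of t that stays nonnegative has slope 0. *)
Lemma quadratic_ge0_disc (A B D : R) : 0 <= D ->
  (forall t, 0 <= A + 2 * t * B + t ^+ 2 * D) -> B ^+ 2 <= A * D.
Proof.
rewrite le_eqVlt => /predU1P[D0|D0] h; last first.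
- have := h (- B / D).
  rewrite (_ : _ + _ = (A * D - B ^+ 2) / D); last by field; rewrite gt_eqF.
  by rewrite pmulr_lge0 ?invr_gt0// subr_ge0.
- have [->|B0] := eqVneq B 0; first by rewrite -D0 mulr0 expr0n.
  have := h (- (A + 1) / (2 * B)); rewrite -D0 mulr0 addr0.
  rewrite (_ : _ + _ = - 1); first by rewrite oppr_ge0 ler10.
  by field.
Qed.

(** The ratios of consecutive terms do not decrease, so an initial step up would force geometric
    growth. *)
Lemma log_convex_bounded (s : nat -> R) (K : R) : (forall n, 0 <= s n) ->
  (forall n, s n.+1 ^+ 2 <= s n * s n.+2) -> (forall n, s n <= K) ->
  s 1%N <= s 0%N.
Proof.
move=> s0 sc sK; rewrite leNgt; apply/negP => s01.
have s00 : 0 < s 0%N.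
  rewrite lt_neqAle s0 andbT eq_sym; apply/negP => /eqP s00.
  have := sc 0%N; rewrite s00 mul0r; have := s0 0%N; move: s01; rewrite s00; nra.
pose r := s 1%N / s 0%N.
have r1 : 1 < r by rewrite ltr_pdivlMr// mul1r.
have r0 := lt_trans ltr01 r1.
have grow n : 0 < s n /\ r * s n <= s n.+1.
  elim: n => [|n [sn IH]]; first by rewrite /r divfK ?gt_eqF.
  have sn1 : 0 < s n.+1 by rewrite (lt_le_trans _ IH)// mulr_gt0.
  split=> //; rewrite -(ler_pM2l sn) (le_trans _ (sc n))// expr2 mulrA.
  by rewrite ler_pM2r// mulrC.
have growX n : r ^+ n * s 0%N <= s n.
  elim: n => [|n IH]; first by rewrite expr0 mul1r.
  apply: le_trans (grow n).2; rewrite exprS -mulrA ler_pM2l//.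
have K0 : 0 < K by apply: lt_le_trans s00 (sK 0%N).
have : r^-1 ^+ n @[n --> \oo] --> 0.
  by apply: cvg_expr; rewrite normfV gtr0_norm// invf_lt1.
move/cvgrPdist_lt => /(_ (s 0%N / K)); rewrite divr_gt0// => /(_ isT)[n _].
move=> /(_ n (leqnn n)) /=; rewrite sub0r normrN ger0_norm ?exprn_ge0 ?invr_ge0 ?ltW//.
rewrite exprVn ltr_pdivlMr// ltNge => /negP; apply.
rewrite ler_pdivlMl ?exprn_gt0// (le_trans (growX n))//.
Qed.

Variables (mu : nat -> R) (K : R).
Hypothesis mu_psd : forall (c : nat -> R) N,
  0 <= \sum_(i < N) \sum_(j < N) c i * c j * mu (i + j)%N.
Hypothesis mu_bounded : forall n, `|mu n| <= K.
Hypothesis mu_odd : forall n, odd n -> mu n = 0.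
Hypothesis mu0_gt0 : 0 < mu 0%N.

Implicit Types q r : {poly R}.

Definition mfun q : R := \sum_(i < size q) q`_i * mu i.
Local Notation L := mfun.

Lemma mfun_widen q N : (size q <= N)%N -> L q = \sum_(i < N) q`_i * mu i.
Proof.
move=> qN; rewrite /mfun (big_ord_widen _ (fun i => q`_i * mu i) qN) big_mkcond.
apply: eq_bigr => i _; case: ltnP => // h.
by rewrite nth_default ?mul0r.
Qed.

Lemma mfunD q r : L (q + r) = L q + L r.
Proof.
pose N := maxn (size q) (size r).
rewrite (mfun_widen (size_polyD q r)) (@mfun_widen q N) ?leq_maxl//.
rewrite (@mfun_widen r N) ?leq_maxr// -big_split; apply: eq_bigr => i _ /=.
by rewrite coefD mulrDl.
Qed.

Lemma mfunZ c q : L (c *: q) = c * L q.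
Proof.
rewrite (mfun_widen (size_scale_leq c q)) mulr_sumr; apply: eq_bigr => i _.
by rewrite coefZ mulrA.
Qed.

Lemma mfunN q : L (- q) = - L q.
Proof. by rewrite -scaleN1r mfunZ mulN1r. Qed.

Lemma mfunB q r : L (q - r) = L q - L r.
Proof. by rewrite mfunD mfunN. Qed.

Lemma mfun_sum (I : Type) (s : seq I) (F : I -> {poly R}) :
  L (\sum_(i <- s) F i) = \sum_(i <- s) L (F i).
Proof.
elim: s => [|i s IH]; last by rewrite !big_cons mfunD IH.
by rewrite !big_nil /mfun size_poly0 big_ord0.
Qed.

Lemma mfunXn n : L 'X^n = mu n.
Proof.
rewrite /mfun size_polyXn big_ord_recr /= big1 ?add0r ?coefXn ?eqxx ?mul1r//.
by move=> i _; rewrite coefXn (ltn_eqF (ltn_ord i)) mul0r.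
Qed.

Lemma mfunXnM n q : L ('X^n * q) = \sum_(i < size q) q`_i * mu (n + i)%N.
Proof.
rewrite -{1}[q]coefK poly_def mulr_sumr mfun_sum; apply: eq_bigr => i _.
by rewrite -scalerAr mfunZ -exprD mfunXn.
Qed.

Lemma mfun_sqr_ge0 q : 0 <= L (q * q).
Proof.
have := mu_psd (fun i => q`_i) (size q); congr (_ <= _).
transitivity (L ((\poly_(i < size q) q`_i) * q)); last by rewrite coefK.
rewrite poly_def mulr_suml mfun_sum; apply: eq_bigr => i _.
rewrite -scalerAl mfunZ mfunXnM mulr_sumr; apply: eq_bigr => j _.
by rewrite mulrA.
Qed.

Lemma mfun_CauchySchwarz q r : L (q * r) ^+ 2 <= L (q * q) * L (r * r).
Proof.
apply: quadratic_ge0_disc => [|t]; first exact: mfun_sqr_ge0.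
 have := mfun_sqr_ge0 (q + t *: r).
congr (_ <= _).
have -> : (q + t *: r) * (q + t *: r) =
    q * q + (t + t) *: (q * r) + (t * t) *: (r * r).
  by rewrite -!mul_polyC polyCM polyCD; ring.
by rewrite !mfunD !mfunZ; ring.
Qed.

Lemma mfun_null q r : L (r * r) = 0 -> L (q * r) = 0.
Proof.
move=> r0; apply/eqP; rewrite -sqrf_eq0 eq_le sqr_ge0 andbT.
by rewrite (le_trans (mfun_CauchySchwarz q r))// r0 mulr0.
Qed.

(** Expresses support in [-1, 1]: the numbers L (X^(2n) q^2) are log-convex in n by Cauchy-Schwarz,
    and bounded because all moments are. *)
Lemma mfun_contract q : L ('X * q * ('X * q)) <= L (q * q).
Proof.
pose s n := L ('X^n * q * ('X^n * q)).
suff: s 1%N <= s 0%N by rewrite /s expr1 expr0 mul1r.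
apply: (@log_convex_bounded _ (\sum_(i < size (q * q)) `|(q * q)`_i| * K)).
- by move=> n; exact: mfun_sqr_ge0.
- move=> n; apply: le_trans (mfun_CauchySchwarz _ _).
  have -> // : 'X^n * q * ('X^(n.+2) * q) =
      'X^(n.+1) * q * ('X^(n.+1) * q) :> {poly R}.
  by rewrite !exprS; ring.
- move=> n; rewrite /s (_ : _ * _ = 'X^(n + n) * (q * q)); last first.
    by rewrite exprD; ring.
  rewrite mfunXnM (le_trans (ler_norm _))// (le_trans (ler_norm_sum _ _ _))//.
  by apply: ler_sum => i _; rewrite normrM ler_wpM2l.
Qed.

Lemma mfun_compNX q : L (q \Po - 'X) = L q.
Proof.
rewrite -[q]coefK poly_def raddf_sum !mfun_sum; apply: eq_bigr => i _ /=.
rewrite comp_polyZ !mfunZ comp_Xn_poly exprNn.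
rewrite -signr_odd; case: (boolP (odd i)) => oi; last by rewrite mul1r.
by rewrite mulN1r mfunN mfunXn mu_odd// oppr0.
Qed.

(* If the functional is degenerate, the quotient is 0 from some point on, by the
   convention x / 0 = 0, and the recurrence decouples there. *)
Fixpoint jacobi_pair n : {poly R} * {poly R} :=
  if n is n'.+1 then
    let: (a, b) := jacobi_pair n' in (b, 'X * b - (L (b * b) / L (a * a)) *: a)
  else (1, 'X).

Definition opoly n := (jacobi_pair n).1.
Local Notation P := opoly.
Local Notation h n := (L (P n * P n)).

Lemma opoly0 : P 0%N = 1. Proof. by []. Qed.
Lemma opoly1 : P 1%N = 'X. Proof. by []. Qed.

Lemma XMopoly n : 'X * P n.+1 = P n.+2 + (h n.+1 / h n) *: P n.
Proof.
rewrite /opoly /=; case: (jacobi_pair n) => a b /=.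
by rewrite subrK.
Qed.

Lemma opoly_parity n : P n \Po - 'X = (-1) ^+ n *: P n.
Proof.
suff: P n \Po - 'X = (-1) ^+ n *: P n /\ P n.+1 \Po - 'X = (-1) ^+ n.+1 *: P n.+1.
  by case.
elim: n => [|n [IH IH1]].
  by rewrite opoly0 opoly1 comp_polyX rmorph1 expr0 expr1 scale1r scaleN1r.
split=> //; have -> : P n.+2 = 'X * P n.+1 - (h n.+1 / h n) *: P n.
  by rewrite XMopoly addrK.
rewrite rmorphB rmorphM /= comp_polyX comp_polyZ IH IH1 scalerBr.
rewrite !exprS !mulN1r opprK mulNr scaleNr mulrN opprK -scalerAr.
by rewrite !scalerA [_ * (-1) ^+ n]mulrC.
Qed.

(** By parity X P_n^2 is odd. This is the zero diagonal of the Jacobi matrix, and the reason why the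
    recurrence has no term in P_(n+1) alone. *)
Lemma mfunX_opoly n : L ('X * P n * P n) = 0.
Proof.
have : L (('X * P n * P n) \Po - 'X) = - L ('X * P n * P n).
  rewrite !rmorphM /= comp_polyX opoly_parity -!scalerAr -!scalerAl scalerA.
  by rewrite -exprD addnn -signr_odd odd_double scale1r !mulNr mfunN.
rewrite mfun_compNX => /eqP; rewrite -subr_eq0 opprK -mulr2n mulrn_eq0 /=.
by move/eqP.
Qed.

Lemma mfunC q r : L (q * r) = L (r * q). Proof. by rewrite mulrC. Qed.

(** The two claims need each other: subtracting (h (n+1) / h n) P_n makes P_(n+2) orthogonal to P_n
    because L (X P_n P_(n+1)) = h (n+1), and that value comes from expanding X P_n and using
    orthogonality. *)
Lemma opoly_orthog_norm n :
  (forall m, (m < n.+1)%N -> L (P m * P n.+1) = 0) /\ L ('X * P n * P n.+1) = h n.+1.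
Proof.
elim/ltn_ind: n => n IH.
have orth k m : (k <= n)%N -> (m < k)%N -> L (P m * P k) = 0.
  by case: k => // k kn mk; apply: (IH k kn).1.
case: n => [|n] in IH orth *.
  rewrite opoly0 opoly1 mulr1; split=> // m; rewrite ltnS leqn0 => /eqP ->.
  by rewrite opoly0 mul1r -[X in L X]expr1 mfunXn mu_odd.
have norm : L ('X * P n * P n.+1) = h n.+1 by case: (IH n (ltnSn n)).
(* If h n = 0, the quotient in the recurrence is 0 by convention and subtracts nothing;
   orthogonality to P_n then rests on h (n+1) = 0. *)
have h0 : h n = 0 -> h n.+1 = 0.
  by move=> hn; rewrite -norm mulrAC mfun_null.
have PE : P n.+2 = 'X * P n.+1 - (h n.+1 / h n) *: P n by rewrite XMopoly addrK.
have orth2 m : (m < n.+2)%N -> L (P m * P n.+2) = 0.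
  move=> mn; rewrite PE mulrBr -scalerAr mfunB mfunZ.
  move: mn; rewrite ltnS leq_eqVlt => /predU1P[->|].
    by rewrite [P _ * ('X * _)]mulrC mfunX_opoly [P n.+1 * P n]mulrC
      (orth n.+1 n) ?mulr0 ?subr0.
  rewrite ltnS leq_eqVlt => /predU1P[->|mn].
    rewrite mulrCA mulrA norm; have [hn|hn] := eqVneq (h n) 0.
      by rewrite hn mulr0 subr0 h0.
    by rewrite divfK ?subrr.
  rewrite (orth n m) ?mulr0 ?subr0// mulrCA mulrA.
  case: m => [|m] in mn *.
    by rewrite opoly0 mulr1 -opoly1 orth.
  rewrite XMopoly mulrDl -scalerAl mfunD mfunZ (orth n.+1 m.+2)// (orth n.+1 m) ?mulr0 ?addr0//.
  by apply: ltnW; apply: ltnW.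
by split=> //; rewrite XMopoly mulrDl -scalerAl mfunD mfunZ (orth2 n) ?mulr0 ?addr0.
Qed.

Lemma opoly_orthog m n : m != n -> L (P m * P n) = 0.
Proof.
wlog mn : m n / (m < n)%N => [H mn|_].
  have [mltn|nltm] := ltnP m n; first exact: H.
  by rewrite mfunC H 1?eq_sym// ltn_neqAle eq_sym mn.
by case: n mn => // n mn; apply: (opoly_orthog_norm n).1.
Qed.

Lemma opoly_norm n : L ('X * P n * P n.+1) = h n.+1.
Proof. by case: (opoly_orthog_norm n). Qed.

Lemma opoly_norm_null n : h n = 0 -> h n.+1 = 0.
Proof.
by move=> hn; rewrite -opoly_norm mulrAC mfun_null.
Qed.

Lemma opoly_norm_le n : h n.+1 <= h n.
Proof.
have := mfun_CauchySchwarz ('X * P n) (P n.+1); rewrite opoly_norm expr2.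
have := mfun_sqr_ge0 (P n.+1); rewrite le_eqVlt => /predU1P[<- _|h0].
  exact: mfun_sqr_ge0.
by rewrite ler_pM2r// => /le_trans; apply; exact: mfun_contract.
Qed.

Definition jacobi_weight n := Num.sqrt (h n.+1 / h n).
Local Notation b := jacobi_weight.

(** This is <A^n d_0, d_k>, where A is multiplication by X and d_k the normalized P_k. If h k = 0 it
    is 0 by the convention for division. *)
Definition jacobi_entry n k := L ('X^n * P k) / Num.sqrt (h k * h 0%N).
Local Notation A := jacobi_entry.

Lemma jacobi_weight_ge0 n : 0 <= b n.
Proof. exact: sqrtr_ge0. Qed.

Lemma jacobi_weight_le1 n : b n <= 1.
Proof.
rewrite -[leRHS]sqrtr1 ler_wsqrtr//.
have := mfun_sqr_ge0 (P n); rewrite le_eqVlt => /predU1P[<-|h0].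
  by rewrite invr0 mulr0.
by rewrite ler_pdivrMr// mul1r opoly_norm_le.
Qed.

Lemma opoly_norm0 : h 0%N = mu 0%N.
Proof. by rewrite opoly0 mulr1 -(expr0 'X) mfunXn. Qed.

Lemma jacobi_entry_col0 n : A n 0%N = mu n / mu 0%N.
Proof.
rewrite /A opoly0 mulr1 mfunXn -{2}opoly0 opoly_norm0 -expr2 sqrtr_sqr.
by rewrite ger0_norm// ltW.
Qed.

Lemma jacobi_entry_row0 k : A 0%N k = (k == 0%N)%:R.
Proof.
case: k => [|k]; first by rewrite jacobi_entry_col0 divff// gt_eqF.
by rewrite /A expr0 -opoly0 opoly_orthog// mul0r.
Qed.

Let weight_up n k : L ('X^n * P k.+1) / Num.sqrt (h k * h 0%N) = b k * A n k.+1.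
Proof.
have [hk|hk] := eqVneq (h k.+1) 0; first by rewrite /A mfun_null// !mul0r mulr0.
have hk0 : h k != 0 by apply: contra_neq hk; exact: opoly_norm_null.
have H0 : h 0%N != 0 by rewrite opoly_norm0 gt_eqF.
have [p0 p1 p2] := And3 (mfun_sqr_ge0 (P 0)) (mfun_sqr_ge0 (P k)) (mfun_sqr_ge0 (P k.+1)).
rewrite /A /b !sqrtrM ?sqrtrV//.
field.
by rewrite !sqrtr_eq0 -!ltNge !lt_neqAle p0 p1 p2 ![0 == _]eq_sym H0 hk0 hk.
Qed.

Lemma jacobi_entryS0 n : A n.+1 0%N = b 0%N * A n 1%N.
Proof.
by rewrite -weight_up /A opoly0 opoly1 mulr1 exprSr.
Qed.

Lemma jacobi_entrySS n k : A n.+1 k.+1 = b k.+1 * A n k.+2 + b k * A n k.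
Proof.
rewrite -weight_up [LHS]/A exprSr -mulrA XMopoly mulrDr -scalerAr mfunD mfunZ mulrDl.
congr (_ + _).
have [hk|hk] := eqVneq (h k.+1) 0; first by rewrite /b hk !(mul0r, sqrtr0).
have hk0 : h k != 0 by apply: contra_neq hk; exact: opoly_norm_null.
have H0 : h 0%N != 0 by rewrite opoly_norm0 gt_eqF.
have [p0 p1 p2] := And3 (mfun_sqr_ge0 (P 0)) (mfun_sqr_ge0 (P k)) (mfun_sqr_ge0 (P k.+1)).
rewrite /A /b !sqrtrM ?sqrtrV//.
rewrite -{1}(sqr_sqrtr p1) -{1}(sqr_sqrtr p2).
field.
by rewrite !sqrtr_eq0 -!ltNge !lt_neqAle p0 p1 p2 ![0 == _]eq_sym H0 hk0 hk.
Qed.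

End JacobiCoefficients.

(** * Newton series and differences of the moments *)

Section Differences.
Variable K : numFieldType.
Implicit Types (f : nat -> K) (z : K).

(** The n-th power of 1 - shift, a sign for which completely monotone sequences have nonnegative
    differences. *)
Fixpoint fdiff f n : nat -> K :=
  if n is n'.+1 then fun j => fdiff f n' j - fdiff f n' j.+1 else f.

Lemma eq_fdiff f g n j : f =1 g -> fdiff f n j = fdiff g n j.
Proof. by move=> fg; elim: n j => [|n IH] j /=; rewrite ?fg ?IH. Qed.

Lemma fdiffD f g n j : fdiff (fun k => f k + g k) n j = fdiff f n j + fdiff g n j.
Proof. by elim: n j => [//|n IH] j /=; rewrite !IH; ring. Qed.

Lemma fdiffZ c f n j : fdiff (fun k => c * f k) n j = c * fdiff f n j.
Proof. by elim: n j => [//|n IH] j /=; rewrite !IH; ring. Qed.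

Lemma fdiff_cst c n j : fdiff (fun=> c) n.+1 j = 0.
Proof. by elim: n j => [|n IH] j /=; [rewrite subrr | rewrite -!/(fdiff _ _.+1 _) !IH subrr]. Qed.

(** The Leibniz rule for 1 - shift, which sends k + 1 to the constant -1. *)
Lemma fdiff_mulX f n j : fdiff (fun k => k.+1%:R * f k) n.+1 j =
  (j + n.+2)%:R * fdiff f n.+1 j - n.+1%:R * fdiff f n j.
Proof.
elim: n j => [|n IH] j; first by rewrite /= !natrD; ring.
rewrite [LHS]/= -!/(fdiff _ n.+1 _) !IH [fdiff f n.+2 j]/= -!/(fdiff _ n.+1 _).
rewrite [fdiff f n.+1 j]/= [fdiff f n.+1 j.+1]/= !natrD.
ring.
Qed.

(* The coefficient binomial(n - z, n) of the Newton series at z. *)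
Definition theta z n : K := \prod_(k < n) (1 - z / k.+1%:R).

Lemma thetaS z n : theta z n.+1 * n.+1%:R = theta z n * (n.+1%:R - z).
Proof.
by rewrite /theta big_ord_recr /= -mulrA mulrBl mul1r divfK ?pnatr_eq0.
Qed.

Lemma theta0 z : theta z 0 = 1. Proof. by rewrite /theta big_ord0. Qed.

(* Summation by parts; up to the boundary term, multiplying f k by k + 1
   multiplies its Newton series by z. *)
Lemma sum_theta_fdiff_mulX z f N :
  \sum_(n < N.+1) theta z n * fdiff (fun k => k.+1%:R * f k) n 0 =
  z * (\sum_(n < N.+1) theta z n * fdiff f n 0) + theta z N.+1 * N.+1%:R * fdiff f N 0.
Proof.
elim: N => [|N IH].
  by rewrite !big_ord_recr !big_ord0 /= thetaS theta0; ring.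
rewrite big_ord_recr IH [in RHS]big_ord_recr /= -!/(fdiff _ N.+1 _).
rewrite fdiff_mulX add0n [theta z N.+2 * _]thetaS.
by ring.
Qed.

End Differences.

Section ComplexModulus.
Variable R : realType.
Notation C := R[i].

Definition cabs (z : C) : R := complex.Re `|z|.

Lemma cabsE z : (cabs z)%:C = `|z|.
Proof. by rewrite /cabs RRe_real// ger0_real. Qed.

Lemma cabs_ge0 z : 0 <= cabs z.
Proof. by rewrite -ler0c cabsE. Qed.

Lemma cabsM z w : cabs (z * w) = cabs z * cabs w.
Proof. by apply: (@fmorph_inj _ _ (real_complex R)); rewrite rmorphM /= !cabsE normrM. Qed.

Lemma cabsD z w : cabs (z + w) <= cabs z + cabs w.
Proof. by rewrite -lecR rmorphD /= !cabsE ler_normD. Qed.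

Lemma cabs_real x : cabs x%:C = `|x|.
Proof.
apply: (@fmorph_inj _ _ (real_complex R)).
by rewrite /= cabsE normc_def /= expr0n addr0 sqrtr_sqr.
Qed.

Lemma cabs_eq0 z : cabs z = 0 -> z = 0.
Proof. by move=> z0; apply/normr0_eq0; rewrite -cabsE z0. Qed.

Lemma cabsX z k : cabs (z ^+ k) = cabs z ^+ k.
Proof. by elim: k => [|k IH]; rewrite ?(cabs_real 1) ?normr1// !exprS cabsM IH. Qed.

Lemma cabsN z : cabs (- z) = cabs z.
Proof. by rewrite /cabs normrN. Qed.

Lemma cabs_conj z : cabs z^* = cabs z.
Proof. by rewrite /cabs norm_conjC. Qed.

Lemma cabs_sqr z : cabs z ^+ 2 = complex.Re z ^+ 2 + complex.Im z ^+ 2.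
Proof. by rewrite /cabs normc_def /= sqr_sqrtr// addr_ge0 ?sqr_ge0. Qed.

Lemma cabs_sum (I : Type) (r : seq I) (F : I -> C) :
  cabs (\sum_(i <- r) F i) <= \sum_(i <- r) cabs (F i).
Proof.
elim: r => [|i r IH]; first by rewrite !big_nil (cabs_real 0) normr0.
by rewrite !big_cons (le_trans (cabsD _ _))// lerD2l.
Qed.

Lemma ler_cabs_Im z : `|complex.Im z| <= cabs z.
Proof.
rewrite -(ler_pXn2r (n := 2)) ?nnegrE ?cabs_ge0// cabs_sqr real_normK ?num_real//.
by rewrite lerDr sqr_ge0.
Qed.

Lemma ler_cabs_Re z : `|complex.Re z| <= cabs z.
Proof.
rewrite -(ler_pXn2r (n := 2)) ?nnegrE ?cabs_ge0// cabs_sqr real_normK ?num_real//.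
by rewrite lerDl sqr_ge0.
Qed.

End ComplexModulus.

(** * Newton coefficients on the line Re z = e *)

Section ThetaBounds.
Variables (R : realType) (e : R).
Notation C := R[i].
Hypotheses (e0 : 0 < e) (e1 : e <= 2^-1).

Lemma theta_factor_gt0 k : 0 < 1 - e / k.+1%:R.
Proof.
rewrite subr_gt0 ltr_pdivrMr ?ltr0n// mul1r (le_lt_trans e1)//.
by rewrite (@lt_le_trans _ _ 1) ?invf_lt1 ?ltr1n// ler1n.
Qed.

Lemma theta_gt0 n : 0 < theta e n.
Proof. by rewrite prodr_gt0// => k _; exact: theta_factor_gt0. Qed.

Lemma thetaS_le n : theta e n.+1 <= theta e n.
Proof.
rewrite /theta big_ord_recr /= ger_pMr; last exact: theta_gt0.
by rewrite gerBl divr_ge0 ?ler0n ?ltW.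
Qed.

Lemma theta_half n : theta e n <= theta (e / 2) n ^+ 2.
Proof.
rewrite /theta -prodrXl; apply: ler_prod => k _; rewrite ltW ?theta_factor_gt0//=.
rewrite -subr_ge0 (_ : _ - _ = (e / 2 / k.+1%:R) ^+ 2) ?sqr_ge0//.
by have : k.+1%:R != 0 :> R by []; move: (k.+1%:R) => t t0; field.
Qed.

(** Since (1 - t) (1 + G + t) <= 1 + G for t, G >= 0, the left side does not increase with n. The
    divergence of the harmonic series then sends theta to 0. *)
Lemma theta_harmonic n : theta e n * (1 + e * \sum_(k < n) k.+1%:R^-1) <= 1.
Proof.
elim: n => [|n IH]; first by rewrite theta0 big_ord0 mulr0 addr0 mul1r.
apply: le_trans IH; rewrite /theta big_ord_recr /= -mulrA ler_pM2l; last first.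
  by rewrite prodr_gt0// => k _; exact: theta_factor_gt0.
rewrite [in leLHS]big_ord_recr /=; set H := \sum_(_ < _) _.
have H0 : 0 <= H by apply: sumr_ge0.
set t := e / n.+1%:R; have t0 : 0 <= t by rewrite divr_ge0 ?ler0n// ltW.
rewrite [e * (H + _)]mulrDr -/t; have : 0 <= e * H by rewrite mulr_ge0// ltW.
by move: (e * H) => G G0; nra.
Qed.

Lemma theta_le m n : (m <= n)%N -> theta e n <= theta e m.
Proof. by move=> /subnK <-; elim: (n - m)%N => // k IH; exact: le_trans (thetaS_le _) IH. Qed.

Lemma cvg_theta : theta e n @[n --> \oo] --> 0.
Proof.
apply/cvgrPdist_le => eps eps0.
have [N HN] : exists N, (eps * e)^-1 < \sum_(k < N) k.+1%:R^-1.
  apply: contrapT => /forallNP h; apply: (@dvg_harmonic R).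
  apply: nondecreasing_is_cvgn.
    by apply/nondecreasing_seqP => n; rewrite !seriesEord /= big_ord_recr lerDl invr_ge0.
  exists (eps * e)^-1 => _ [n _ <-]; rewrite seriesEord /=.
  by rewrite leNgt; apply/negP => /(h n).
exists N => // n /= Nn; rewrite sub0r normrN gtr0_norm ?theta_gt0//.
apply: le_trans (theta_le Nn) _.
have := theta_harmonic N; move: HN; set H := \sum_(_ < _) _ => HN.
have He : eps^-1 < e * H by rewrite -ltr_pdivrMl// -invfM mulrC.
have He0 : 0 < 1 + e * H by rewrite addr_gt0// (lt_trans _ He)// invr_gt0.
rewrite -ler_pdivlMr// => /le_trans; apply; rewrite div1r.
by rewrite -[leRHS]invrK lef_pV2 ?posrE ?invr_gt0// (le_trans (ltW He))// lerDr.
Qed.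

Definition zline : C := Complex e 1.

Lemma cabs_thetaS n : cabs (theta zline n.+1) * n.+1%:R =
  cabs (theta zline n) * Num.sqrt ((n.+1%:R - e) ^+ 2 + 1).
Proof.
have /(congr1 (@cabs R)) := thetaS zline n; rewrite !cabsM.
have -> : n.+1%:R = (n.+1%:R)%:C :> C by rewrite (rmorph_nat (real_complex R)).
rewrite cabs_real ger0_norm// => ->; congr (_ * _).
rewrite -[LHS]ger0_norm ?cabs_ge0// -sqrtr_sqr cabs_sqr; congr Num.sqrt.
by rewrite /=; ring.
Qed.

Definition theta_const : R := expR 8.

Lemma cabs_theta_le n : cabs (theta zline n) <= theta_const * theta e n.
Proof.
(* As n + 1 - e >= (n + 1) / 2, the factor |n + 1 - z| / (n + 1 - e) is at most 1 + 2 / (n + 1)^2,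
   and 2 / (n + 1)^2 <= 8 / (n + 1) - 8 / (n + 2). The stronger bound telescopes, with total
   exponent 8. *)
suff h : cabs (theta zline n) <= expR (8 - 8 / n.+1%:R) * theta e n.
  apply: (le_trans h); rewrite ler_pM2r ?theta_gt0// ler_expR gerBl.
  by rewrite divr_ge0.
elim: n => [|n IH].
  by rewrite !theta0 (cabs_real 1) normr1 divr1 subrr expR0 mulr1.
have n0 : 0 < n.+1%:R :> R by rewrite ltr0n.
rewrite -(ler_pM2r n0) cabs_thetaS -[leRHS]mulrA thetaS.
have ne : 0 < n.+1%:R - e.
  by rewrite subr_gt0 (le_lt_trans e1)// (@lt_le_trans _ _ 1) ?invf_lt1 ?ltr1n ?ler1n.
pose t := 2 / n.+1%:R ^+ 2 : R.
have st : Num.sqrt ((n.+1%:R - e) ^+ 2 + 1) <= (n.+1%:R - e) * expR t.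
  have : Num.sqrt ((n.+1%:R - e) ^+ 2 + 1) <= (n.+1%:R - e) * (1 + t).
    have t0 : 0 <= t by rewrite divr_ge0 ?sqr_ge0.
    rewrite -[leRHS]ger0_norm; last first.
      by apply: mulr_ge0; [exact: ltW | exact: addr_ge0].
    rewrite -sqrtr_sqr ler_wsqrtr// exprMn.
    have : 1 <= (n.+1%:R - e) ^+ 2 * (2 * t).
      rewrite /t !mulrA ler_pdivlMr ?exprn_gt0// mul1r.
      have : 1 <= n.+1%:R :> R by rewrite ler1n.
      by move: (n.+1%:R) ne => x; move: e1 e0; nra.
    by move: t t0 ((n.+1%:R - e) ^+ 2) (sqr_ge0 (n.+1%:R - e)) => t' t'0 E; nra.
  by move=> /le_trans; apply; rewrite ler_pM2l// expR_ge1Dx.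
apply: (@le_trans _ _ (expR (8 - 8 / n.+1%:R) * theta e n * ((n.+1%:R - e) * expR t))).
  by rewrite ler_pM ?cabs_ge0 ?sqrtr_ge0.
rewrite [_ * expR t]mulrC mulrACA -expRD ler_pM2r ?mulr_gt0 ?theta_gt0// ler_expR /t.
have x1 : 1 <= n.+1%:R :> R by rewrite ler1n.
rewrite -[n.+2]addn1 natrD -subr_ge0; move: (n.+1%:R) x1 => x x1.
have x0 : x != 0 by rewrite gt_eqF// (lt_le_trans ltr01).
have x10 : x + 1 != 0 by rewrite gt_eqF//; lra.
rewrite (_ : _ - _ = (6 * x - 2) / (x ^+ 2 * (x + 1))); last by field; rewrite x0 x10.
by rewrite divr_ge0 ?mulr_ge0 ?sqr_ge0//; lra.
Qed.

End ThetaBounds.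

Section NewtonSeries.
Variable R : realType.
Notation C := R[i].

Definition newton (f : R -> R) n : R := fdiff (fun k => f k.+1%:R) n 0.

Lemma fdiff_cvg (F : nat -> nat -> R) (f : nat -> R) m j :
  (forall k, F n k @[n --> \oo] --> f k) ->
  fdiff (F n) m j @[n --> \oo] --> fdiff f m j.
Proof. by move=> Ff; elim: m j => [//|m IH] j /=; apply: cvgB. Qed.

Lemma natMC k (a : R) : k%:R * a%:C = (k%:R * a)%:C :> C.
Proof. by rewrite (rmorphM (real_complex R)) (rmorph_nat (real_complex R)). Qed.

Lemma fdiff_real (f : nat -> R) n j :
  fdiff (fun k => (f k)%:C : C) n j = (fdiff f n j)%:C.
Proof. by elim: n j => [//|n IH] j /=; rewrite !IH (rmorphB (real_complex R)). Qed.

(** How the cone is used: an inequality that is linear and pointwise continuous in f is checked on 1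
    / (x + u) only. *)
Lemma stieltjes_functional_ge0 (Phi : (R -> R) -> R) :
  (forall f g, Phi (fun x => f x + g x) = Phi f + Phi g) ->
  (forall c f, Phi (fun x => c * f x) = c * Phi f) ->
  (forall (F : nat -> R -> R) f, (forall x, 0 < x -> F n x @[n --> \oo] --> f x) ->
    Phi (F n) @[n --> \oo] --> Phi f) ->
  (forall u, 0 <= u -> 0 <= Phi (fun x => (x + u)^-1)) ->
  forall f, stieltjes f -> 0 <= Phi f.
Proof.
move=> PhiD PhiZ Phi_cvg Phi_inv f; elim=> {f}.
- exact: Phi_inv.
- by move=> f g _ f0 _ g0; rewrite PhiD addr_ge0.
- by move=> c f c0 _ f0; rewrite PhiZ mulr_ge0.
- move=> F f _ F0 /Phi_cvg Ff; apply: (cvgr_to_ge Ff); exact: nearW.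
Qed.

Section Inv.
Variables (K : numFieldType) (u : K).
Hypothesis u0 : 0 <= u.
Let g k : K := (k.+1%:R + u)^-1.

Let gE k : k.+1%:R * g k = 1 + (- u) * g k.
Proof.
have gn0 : k.+1%:R + u != 0 by rewrite gt_eqF// ltr_wpDr// ltr0n.
by rewrite /g; move: (k.+1%:R) gn0 => x x0; field.
Qed.

(** Insert (k + 1) g k = 1 - u g k in the summation by parts; the constant 1 contributes only
    through its difference of order 0. *)
Lemma sum_theta_inv z N : (z + u) * (\sum_(n < N.+1) theta z n * fdiff g n 0) =
  1 - theta z N.+1 * (N.+1%:R * fdiff g N 0).
Proof.
have := sum_theta_fdiff_mulX z g N.
under eq_bigr do rewrite (eq_fdiff _ _ gE) fdiffD fdiffZ mulrDr.
rewrite big_split /= big_ord_recl theta0 mul1r [fdiff _ _ _]/= big1; last first.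
  by move=> i _; rewrite lift0 fdiff_cst mulr0.
set S := \sum_(n < N.+1) theta z n * fdiff g n 0.
rewrite addr0 (_ : \sum_(n < N.+1) _ = - u * S); last first.
  by rewrite mulr_sumr; apply: eq_bigr => i _; rewrite mulrCA.
move=> h; transitivity (1 + - u * S + u * S - theta z N.+1 * (N.+1%:R * fdiff g N 0)).
  by rewrite h; ring.
by ring.
Qed.

(** The recurrence of n! / ((1 + u) ... (n + 1 + u)). *)
Lemma fdiff_invS n : (n.+2%:R + u) * fdiff g n.+1 0 = n.+1%:R * fdiff g n 0.
Proof.
have := fdiff_mulX g n 0; rewrite (eq_fdiff _ _ gE) fdiffD fdiffZ fdiff_cst add0r add0n.
move=> h; transitivity (- u * fdiff g n.+1 0 + n.+1%:R * fdiff g n 0 + u * fdiff g n.+1 0).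
  by rewrite h; ring.
by ring.
Qed.

End Inv.

Lemma fdiff_inv_ge0 (u : R) n : 0 <= u -> 0 <= fdiff (fun k => (k.+1%:R + u)^-1) n 0.
Proof.
move=> u0; elim: n => [|n IH]; first by rewrite /= invr_ge0 addr_ge0.
have h : 0 < n.+2%:R + u by rewrite ltr_wpDr// ltr0n.
by rewrite -(pmulr_rge0 _ h) fdiff_invS// mulr_ge0.
Qed.

Lemma fdiff_inv_le (u : R) n : 0 <= u ->
  n.+1%:R * fdiff (fun k => (k.+1%:R + u)^-1) n 0 <= (1 + u)^-1.
Proof.
move=> u0; elim: n => [|n IH]; first by rewrite mul1r.
apply: le_trans IH; rewrite -(fdiff_invS u0 n) ler_wpM2r ?lerDl//.
exact: fdiff_inv_ge0.
Qed.

Lemma newton_ge0 f n : stieltjes f -> 0 <= newton f n.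
Proof.
apply: (stieltjes_functional_ge0 (Phi := fun f => newton f n)).
- by move=> *; exact: fdiffD.
- by move=> *; exact: fdiffZ.
- by move=> F g Fg; apply: fdiff_cvg => k; apply: Fg; rewrite ltr0n.
- by move=> u; exact: fdiff_inv_ge0.
Qed.

Lemma newton_sum_cvg (c : nat -> R) N (F : nat -> R -> R) f :
  (forall x, 0 < x -> F n x @[n --> \oo] --> f x) ->
  \sum_(k < N) c k * newton (F n) k @[n --> \oo] --> \sum_(k < N) c k * newton f k.
Proof.
move=> Ff; apply: cvgn_sum => k; apply: cvgMl_tmp.
by apply: fdiff_cvg => j; apply: Ff; rewrite ltr0n.
Qed.

Lemma newton_sumD (c : nat -> R) N f g :
  \sum_(k < N) c k * newton (fun x => f x + g x) k =
  \sum_(k < N) c k * newton f k + \sum_(k < N) c k * newton g k.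
Proof.
by rewrite -big_split; apply: eq_bigr => k _ /=; rewrite /newton fdiffD mulrDr.
Qed.

Lemma newton_sumZ (c : nat -> R) N a f :
  \sum_(k < N) c k * newton (fun x => a * f x) k = a * \sum_(k < N) c k * newton f k.
Proof.
by rewrite mulr_sumr; apply: eq_bigr => k _ /=; rewrite /newton fdiffZ mulrCA.
Qed.

Section Line.
Variable e : R.
Hypotheses (e0 : 0 < e) (e1 : e <= 2^-1).

(** For 1 / (x + u) the error of the partial sum is the boundary term divided by e + u, which is
    nonnegative at a real point e in (0, 1/2]. *)
Lemma newton_series_le f N : stieltjes f ->
  \sum_(n < N.+1) theta e n * newton f n <= f e.
Proof.
move=> Sf; rewrite -subr_ge0; move: f Sf.
apply: (@stieltjes_functional_ge0
  (fun f => f e - \sum_(n < N.+1) theta e n * newton f n)).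
- by move=> f g; rewrite newton_sumD; ring.
- by move=> c f; rewrite newton_sumZ; ring.
- by move=> F f Ff; apply: cvgB; [exact: Ff | exact: newton_sum_cvg].
- move=> u u0; have eu : 0 < e + u by rewrite ltr_wpDr.
  rewrite subr_ge0 -(ler_pM2l eu) mulfV ?gt_eqF// sum_theta_inv//.
  rewrite gerBl mulr_ge0// ?mulr_ge0 ?fdiff_inv_ge0//.
  by rewrite ltW// theta_gt0.
Qed.

(* For f = 1 / (x + u) the Newton series at e + i sums to 1 / (e + i + u), whose
   imaginary part is bounded away from 0 in terms of f 1 - f 2. *)
Lemma newton_series_Im f N : stieltjes f ->
  (f 1 - f 2) / 2 - cabs (theta (zline e) N.+1) * f 1 <=
  - \sum_(n < N.+1) complex.Im (theta (zline e) n) * newton f n.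
Proof.
move=> Sf; rewrite -subr_ge0; move: f Sf.
apply: (@stieltjes_functional_ge0 (fun f => - \sum_(n < N.+1)
  complex.Im (theta (zline e) n) * newton f n
  - ((f 1 - f 2) / 2 - cabs (theta (zline e) N.+1) * f 1))).
- by move=> f g; rewrite (newton_sumD (fun n => complex.Im (theta (zline e) n))); ring.
- by move=> c f; rewrite (newton_sumZ (fun n => complex.Im (theta (zline e) n))); ring.
- move=> F f Ff.
  have [F1 F2] : F n 1 @[n --> \oo] --> f 1 /\ F n 2 @[n --> \oo] --> f 2.
    by split; apply: Ff.
  have c1 := @newton_sum_cvg (fun n => complex.Im (theta (zline e) n)) N.+1 F f Ff.
  apply: cvgB; first exact: (cvgN c1).
  by apply: cvgB; [apply: cvgMr_tmp; exact: cvgB | exact: cvgMl_tmp].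
- move=> u u0.
  pose y n := fdiff (fun k => (k.+1%:R + u)^-1) n 0 : R.
  have uC0 : 0 <= u%:C :> C by rewrite ler0c.
  have := sum_theta_inv uC0 (zline e) N.
  have yE n : fdiff (fun k => (k.+1%:R + u%:C)^-1) n 0 = (y n)%:C :> C.
    rewrite /y -fdiff_real; apply: eq_fdiff => k.
    by rewrite (fmorphV (real_complex R)) (rmorphD (real_complex R)) (rmorph_nat (real_complex R)).
  under eq_bigr do rewrite yE.
  rewrite yE; set S := \sum_(n < N.+1) _ => hS.
  have ImS : complex.Im S = \sum_(n < N.+1) complex.Im (theta (zline e) n) * y n.
    rewrite /S raddf_sum; apply: eq_bigr => n _ /=.
    by case: (theta _ _) => a b /=; rewrite mulr0 add0r.
  rewrite /newton -ImS.
  pose t := N.+1%:R * y N.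
  have t0 : 0 <= t by rewrite mulr_ge0// fdiff_inv_ge0.
  have t1 : t <= (1 + u)^-1 by exact: fdiff_inv_le.
  have tE : N.+1%:R * (y N)%:C = t%:C :> C by rewrite natMC.
  rewrite tE in hS.
  pose w : C := zline e + u%:C.
  have wE : w = Complex (e + u) 1.
    by rewrite /w /zline; apply/eqP; rewrite eq_complex /= addr0 !eqxx.
  have w0 : w != 0.
    by rewrite wE; apply/negP => /eqP [] _ /eqP; rewrite oner_eq0.
  have SE : S = w^-1 - theta (zline e) N.+1 * t%:C / w.
    by rewrite -[LHS](mulKf w0) -/w hS; field.
  pose d := (e + u) ^+ 2 + 1.
  have d0 : 0 < d by rewrite ltr_wpDl// sqr_ge0.
  have Imw : complex.Im w^-1 = - d^-1.
    by rewrite wE /= expr1n mul1r.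
  have cw : cabs w^-1 <= 1.
    have : cabs w * cabs w^-1 = 1 by rewrite -cabsM mulfV// (cabs_real 1) normr1.
    have := ler_cabs_Im w; rewrite {1}wE /= normr1 => w1 h.
    by rewrite -h ler_peMl// cabs_ge0.
  have : `|complex.Im (theta (zline e) N.+1 * t%:C / w)| <=
      cabs (theta (zline e) N.+1) * (1 + u)^-1.
    apply: le_trans (ler_cabs_Im _) _; rewrite !cabsM cabs_real ger0_norm// -mulrA.
    rewrite ler_wpM2l ?cabs_ge0// -[leRHS]mulr1 ler_pM// ?cabs_ge0//.
  have ImB (a b : C) : complex.Im (a - b) = complex.Im a - complex.Im b by case: a b => ? ? [].
  rewrite SE ImB Imw => /ler_normlP [+ _]; move: (complex.Im _) => I hI.
  have hd : ((1 + u)^-1 - (2 + u)^-1) / 2 <= d^-1.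
    have u1 : 0 < 1 + u by lra.
    have u2 : 0 < 2 + u by lra.
    have -> : ((1 + u)^-1 - (2 + u)^-1) / 2 = (2 * ((1 + u) * (2 + u)))^-1.
      by field; rewrite !gt_eqF.
    rewrite lef_pV2 ?posrE ?mulr_gt0// /d.
    by move: e0 e1; nra.
  by lra.
Qed.

End Line.

(** * Exponents below 1 are impossible *)

Section SmallExponent.
Variable p : R.
Hypotheses (p0 : 0 < p) (p1 : p < 1).
Hypothesis moment_fdiff_ge0 : forall n, 0 <= fdiff (moment p) n 0.

(** [P], [y] and [w] are the Newton coefficients of x^(-p), F and x F, tied by (1 + x^2) F = x^(-p).
    Both [P] and [y] are nonnegative, [P] because x^(-p) is Stieltjes. *)
Let f (x : R) : R := x `^ (- p).
Let Sf : stieltjes f. Proof. exact: stieltjes_powRN. Qed.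
Let P n := newton f n.
Let y n := fdiff (moment p) n 0.
Let w n := fdiff (fun k => k.+1%:R * moment p k) n 0.

Let fE k : k.+1%:R * (k.+1%:R * moment p k) = f k.+1%:R + (-1) * moment p k.
Proof.
rewrite /moment kcoefE /f powRN.
have x0 : 0 < k.+1%:R :> R by rewrite ltr0n.
have := powR_gt0 p x0; move: (_ `^ p) => X X0.
have : 0 < 1 + k.+1%:R ^+ 2 :> R by rewrite ltr_wpDr ?sqr_ge0.
move: (k.+1%:R) x0 => x x0 d0.
by field; rewrite !gt_eqF.
Qed.

Let y_ge0 n : 0 <= y n. Proof. exact: moment_fdiff_ge0. Qed.

Let wE n : w n.+1 = n.+2%:R * y n.+1 - n.+1%:R * y n.
Proof. by rewrite /w fdiff_mulX add0n. Qed.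

Let fdiff_f n : fdiff (fun k => k.+1%:R * (k.+1%:R * moment p k)) n 0 = P n - y n.
Proof. by rewrite (eq_fdiff _ _ fE) fdiffD fdiffZ mulN1r. Qed.

Let PE n : P n.+1 - y n.+1 = n.+2%:R * w n.+1 - n.+1%:R * w n.
Proof. by rewrite -fdiff_f fdiff_mulX add0n. Qed.

Let G n := \sum_(k < n.+1) P k.

(* a = w - i y satisfies (n + 2 + i) a_(n+1) = (n + 1) a_n + P_(n+1). *)
Let cabs_le n : n.+1%:R * cabs (Complex (w n) (- y n)) <= G n.
Proof.
elim: n => [|n IH].
  have w0 : w 0%N = y 0%N by rewrite /w /y /= mul1r.
  have P0 : P 0%N = 2 * y 0%N.
    have : 1%:R * (1%:R * moment p 0%N) = P 0%N - y 0%N := fdiff_f 0%N.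
    by rewrite !mul1r (_ : moment p 0%N = y 0%N)//; lra.
  have E : Complex 1 1 * Complex (w 0%N) (- y 0%N) = (P 0%N)%:C :> C.
    by apply/eqP; rewrite eq_complex /= w0 P0; apply/andP; split; apply/eqP; lra.
  have -> : G 0%N = cabs (P 0%N)%:C.
    by rewrite cabs_real ger0_norm ?newton_ge0// /G big_ord1.
  rewrite -E cabsM ler_wpM2r ?cabs_ge0//.
  by have := ler_cabs_Re (Complex 1 1 : C); rewrite /= normr1.
rewrite /G big_ord_recr /= -/(G n).
have E : Complex n.+2%:R 1 * Complex (w n.+1) (- y n.+1) =
    n.+1%:R%:C * Complex (w n) (- y n) + (P n.+1)%:C :> C.
  have := PE n; rewrite wE => h1; apply/eqP; rewrite eq_complex /=; apply/andP.
  split; apply/eqP; rewrite ?wE; lra.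
apply: (@le_trans _ _ (cabs (Complex n.+2%:R 1 * Complex (w n.+1) (- y n.+1)))).
  rewrite cabsM ler_wpM2r ?cabs_ge0//.
  by apply: le_trans (ler_cabs_Re _); exact: ler_norm.
rewrite E; apply: le_trans (cabsD _ _) _; rewrite cabsM !cabs_real.
by rewrite ger0_norm// [`|P _|]ger0_norm ?newton_ge0// lerD2r.
Qed.

Let y_le n : n.+1%:R * `|y n| <= G n.
Proof.
apply: le_trans (cabs_le n); rewrite ler_wpM2l//.
by have := ler_cabs_Im (Complex (w n) (- y n)); rewrite /= normrN.
Qed.

Let w_le n : n.+1%:R * `|w n| <= G n.
Proof.
apply: le_trans (cabs_le n); rewrite ler_wpM2l//.
by have := ler_cabs_Re (Complex (w n) (- y n)).
Qed.

Section FixedLine.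
Variable e : R.
Hypotheses (e0 : 0 < e) (e1 : e <= 2^-1).
Local Notation T := (theta e).
Local Notation Z := (theta (zline e)).
(** Controls every boundary term at e, because (N + 1) |y N| and (N + 1) |w N| are at most [G N]. *)
Let rem N := T N.+1 * G N.

Let T_ge0 n : 0 <= T n. Proof. exact/ltW/theta_gt0. Qed.

(** Of the two factors at e / 2, one times [G N] is at most f (e / 2), since theta decreases along
    the Newton sum; the other tends to 0. *)
Let rem_cvg : rem N @[N --> \oo] --> 0.
Proof.
have e20 : 0 < e / 2 by rewrite divr_gt0.
have e21 : e / 2 <= 2^-1 by move: e0 e1; lra.
have G0 n : 0 <= G n by apply: sumr_ge0 => k _; exact: newton_ge0.
have Gle n : theta (e / 2) n * G n <= f (e / 2).
  apply: le_trans (newton_series_le e20 e21 n Sf); rewrite /G mulr_sumr.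
  apply: ler_sum => k _; rewrite ler_wpM2r ?newton_ge0//.
  by apply: theta_le => //; rewrite -ltnS.
have c0 : theta (e / 2) N * f (e / 2) @[N --> \oo] --> 0.
  by rewrite -[X in _ --> X](mul0r (f (e / 2))); apply: cvgMr_tmp; exact: cvg_theta.
apply: (squeeze_cvgr _ (cvg_cst 0) c0); apply: nearW => n.
apply/andP; split; first by apply: mulr_ge0 => //; apply/ltW/theta_gt0.
have h : T n.+1 <= theta (e / 2) n ^+ 2.
  by apply: (le_trans (thetaS_le e0 e1 n)); exact: theta_half.
apply: le_trans (ler_wpM2r (G0 n) h) _; rewrite expr2 -mulrA.
by rewrite ler_wpM2l// ltW// theta_gt0.
Qed.

(** Two summations by parts write the sum of T P, which is at most f e, as (1 + e^2) times the sum
    of T y plus boundary terms. Only the one with [w] can be negative, and it is at least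
    -[rem N]. *)
Let sum_y_le N : \sum_(n < N.+1) T n * y n <= f e + rem N.
Proof.
have h1 := sum_theta_fdiff_mulX e (moment p) N.
have := sum_theta_fdiff_mulX e (fun k => k.+1%:R * moment p k) N.
under eq_bigr do rewrite fdiff_f mulrBr.
rewrite sumrB h1 -/(w N) -/(y N) => h2.
have := newton_series_le e0 e1 N Sf; rewrite -/P.
have : `|T N.+1 * N.+1%:R * w N| <= rem N.
  rewrite !normrM -mulrA ger0_norm// ger0_norm//.
  by rewrite ler_wpM2l.
have : 0 <= e * (T N.+1 * N.+1%:R * y N).
  by rewrite !mulr_ge0// ltW.
have : 0 <= e * (e * \sum_(n < N.+1) T n * y n).
  by rewrite mulr_ge0 ?(ltW e0)// mulr_ge0 ?(ltW e0)// sumr_ge0// => i _; rewrite mulr_ge0.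
move: h2; rewrite ler_norml => + + + /andP[+ _].
move: (\sum_(n < N.+1) T n * y n) => Y; move: (\sum_(n < N.+1) T n * newton f n) => Q.
move: (T N.+1 * _ * y N) (T N.+1 * _ * w N) => a b; rewrite mulrDr.
by lra.
Qed.

Let G_ge0 n : 0 <= G n.
Proof. by apply: sumr_ge0 => k _; exact: newton_ge0. Qed.

Let cterm N (a : R) : N.+1%:R * `|a| <= G N ->
  cabs (Z N.+1 * N.+1%:R * a%:C) <= theta_const R * rem N.
Proof.
move=> aG; rewrite -mulrA cabsM.
rewrite natMC cabs_real normrM ger0_norm// /rem [theta_const R * _]mulrA.
by apply: ler_pM => //; [exact: cabs_ge0 | exact: cabs_theta_le].
Qed.

(** The zero of 1 + z^2 at i: at e + i the value is e^2 + 2 e i. This small factor produces the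
    contradiction. *)
Let hz : cabs (1 + zline e ^+ 2) <= 3 * e.
Proof.
rewrite -(ler_pXn2r (n := 2)) ?nnegrE ?cabs_ge0 ?mulr_ge0 ?(ltW e0)// cabs_sqr.
have -> : 1 + zline e ^+ 2 = Complex (e ^+ 2) (2 * e).
  by rewrite expr2; apply/eqP; rewrite eq_complex /=; apply/andP; split; apply/eqP; ring.
have : e ^+ 2 <= 1 by move: e0 e1; nra.
by rewrite /=; have := sqr_ge0 e; rewrite !exprMn; move: (e ^+ 2) => t t0 t1; nra.
Qed.

(** The same two summations by parts at e + i. Here y >= 0 is decisive: with |Z| <= C T it bounds
    the modulus of the sum of Z y by C times the sum of T y. The first 3 is that of [hz], the second
    is 2 + 1 with |e + i| <= 2. *)
Let cmain N : - \sum_(n < N.+1) complex.Im (Z n) * P n <=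
  3 * e * theta_const R * (f e + rem N) + 3 * theta_const R * rem N.
Proof.
have h1 := sum_theta_fdiff_mulX (zline e) (fun k => (moment p k)%:C) N.
have h2 := sum_theta_fdiff_mulX (zline e) (fun k => k.+1%:R * (moment p k)%:C) N.
have wC k : k.+1%:R * (moment p k)%:C = (k.+1%:R * moment p k)%:C :> C.
  by rewrite natMC.
have fC k : k.+1%:R * (k.+1%:R * (moment p k)%:C) =
    (k.+1%:R * (k.+1%:R * moment p k))%:C :> C.
  by rewrite !natMC.
have dy n : fdiff (fun k => (moment p k)%:C) n 0 = (y n)%:C :> C := fdiff_real _ _ _.
have dw n : fdiff (fun k => k.+1%:R * (moment p k)%:C) n 0 = (w n)%:C :> C.
  by rewrite (eq_fdiff _ _ wC) fdiff_real.
have df n : fdiff (fun k => k.+1%:R * (k.+1%:R * (moment p k)%:C)) n 0 =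
    (P n)%:C - (y n)%:C :> C.
  by rewrite (eq_fdiff _ _ fC) fdiff_real fdiff_f (rmorphB (real_complex R)).
move: h1 h2; under eq_bigr do rewrite dw.
under [X in _ = _ * X + _ -> _]eq_bigr do rewrite dy.
rewrite dy; set W := \sum_(n < N.+1) _; set Y := \sum_(n < N.+1) _ => h1.
under eq_bigr do rewrite df mulrBr.
rewrite dw sumrB -/Y; set Q := \sum_(n < N.+1) _ => h2.
have ImQ : complex.Im Q = \sum_(n < N.+1) complex.Im (Z n) * P n.
  rewrite /Q raddf_sum; apply: eq_bigr => n _ /=.
  by case: (theta _ _) => a b /=; rewrite mulr0 add0r.
have QE : Q = (1 + zline e ^+ 2) * Y + (zline e * (Z N.+1 * N.+1%:R * (y N)%:C) +
    Z N.+1 * N.+1%:R * (w N)%:C).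
  transitivity (Q - Y + Y); first by ring.
  by rewrite h2 h1; ring.
rewrite -ImQ (le_trans (ler_norm _))// normrN (le_trans (ler_cabs_Im _))// QE.
apply: le_trans (cabsD _ _) _; apply: lerD; last first.
  apply: le_trans (cabsD _ _) _.
  have z2 : cabs (zline e) <= 2.
    rewrite -(ler_pXn2r (n := 2)) ?nnegrE ?cabs_ge0// cabs_sqr /=.
    by move: e0 e1; nra.
  have := cterm (w_le N); have := cterm (y_le N); rewrite cabsM.
  have : 0 <= cabs (Z N.+1 * N.+1%:R * (y N)%:C) by exact: cabs_ge0.
  move: (cabs (_ * (y N)%:C)) (cabs (_ * (w N)%:C)) => A B A0 hA hB.
  rewrite -mulrA; move: (theta_const R * rem N) hA hB => M hA hB.
  have zA : cabs (zline e) * A <= 2 * A by rewrite ler_wpM2r.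
  rewrite (_ : 3 * M = 2 * M + M); last by ring.
  by apply: lerD => //; apply: le_trans zA _; rewrite ler_wpM2l.
rewrite cabsM -[leRHS]mulrA; apply: ler_pM => //; try exact: cabs_ge0.
apply: le_trans (cabs_sum _ _) _.
apply: (@le_trans _ _ (theta_const R * \sum_(n < N.+1) T n * y n)).
  rewrite mulr_sumr; apply: ler_sum => n _.
  rewrite cabsM cabs_real ger0_norm// mulrA ler_wpM2r//.
  exact: cabs_theta_le.
by rewrite ler_wpM2l ?expR_ge0.
Qed.

Lemma line_bound : (1 - f 2) / 2 <= 3 * theta_const R * (e * f e).
Proof.
have c1 : 3 * e * theta_const R * (f e + rem N) + 3 * theta_const R * rem N
    + theta_const R * T N.+1 @[N --> \oo] -->
    3 * e * theta_const R * (f e + 0) + 3 * theta_const R * 0 + theta_const R * 0.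
  apply: cvgD; last first.
    by apply: cvgMl_tmp; rewrite (cvg_shiftS (theta e)); exact: cvg_theta.
  apply: cvgD; last by apply: cvgMl_tmp; exact: rem_cvg.
  by apply: cvgMl_tmp; apply: cvgD; [exact: cvg_cst | exact: rem_cvg].
have -> : 3 * theta_const R * (e * f e) =
    3 * e * theta_const R * (f e + 0) + 3 * theta_const R * 0 + theta_const R * 0.
  by ring.
apply: (cvgr_to_ge c1); apply: nearW => N.
have := newton_series_Im e0 e1 N Sf; have := cmain N.
have := cabs_theta_le e0 e1 N.+1.
have -> : f 1 = 1 by rewrite /f powR1.
rewrite mulr1 -/P; lra.
Qed.

End FixedLine.

Lemma moment_fdiff_ge0_absurd : False.
Proof.
have f2 : f 2 < 1.
  rewrite /f powRN invf_lt1 ?powR_gt0// -[ltLHS](_ : 1 `^ p = 1); last by rewrite powR1.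
  by apply: gt0_ltr_powR; rewrite ?nnegrE// ltr1n.
have q0 : 0 < 1 - p by rewrite subr_gt0.
pose c := (1 - f 2) / 2; have c0 : 0 < c by rewrite divr_gt0// subr_gt0.
have K0 : 0 < theta_const R by exact: expR_gt0.
(* Chosen so that e^(1-p) <= d makes the right side of [line_bound] at most c / 2; as 1 - p > 0, a
   small e achieves this. *)
pose d := c / (6 * theta_const R); have d0 : 0 < d by rewrite divr_gt0// mulr_gt0.
pose e := Num.min 2^-1 (d `^ (1 - p)^-1).
have e0 : 0 < e by rewrite lt_min invr_gt0 ltr0n powR_gt0.
have e1 : e <= 2^-1 by rewrite ge_min lexx.
have := line_bound e0 e1; rewrite -/c leNgt => /negP; apply.
have -> : e * f e = e `^ (1 - p).
  by rewrite powRD ?(gt_eqF e0) ?implybT// powRr1 ?ltW.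
have : e `^ (1 - p) <= d.
  have h : e <= d `^ (1 - p)^-1 by rewrite ge_min lexx orbT.
  apply: le_trans (ge0_ler_powR _ _ _ h) _; rewrite ?nnegrE ?powR_ge0 ?(ltW q0) ?(ltW e0)//.
  by rewrite -powRrM mulVf ?gt_eqF// powRr1// ltW.
move=> h; apply: (@le_lt_trans _ _ (3 * theta_const R * d)).
  by rewrite ler_pM2l// mulr_gt0.
rewrite (_ : 3 * _ * d = c / 2); last by rewrite /d; field; rewrite gt_eqF.
by rewrite ltr_pdivrMr// ltr_pMr// ltr1n.
Qed.

End SmallExponent.

End NewtonSeries.

(** * Hilbert spaces and orthonormal bases *)

Section HilbertBasics.
Variables (R : realType) (H : hilbertSpace R).
Notation C := R[i].
Notation ip := (inner H).
Implicit Types (x y z : H) (a : C).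

Lemma innerDl x y z : ip (x + y) z = ip x z + ip y z.
Proof. by rewrite linearDl. Qed.

Lemma innerZl a x z : ip (a *: x) z = a * ip x z.
Proof. by rewrite linearZl_LR. Qed.

Lemma innerC x z : ip z x = (ip x z)^*.
Proof. by rewrite hermC /= expr0 mul1r. Qed.

Lemma innerZr a x z : ip x (a *: z) = a^* * ip x z.
Proof. by rewrite linearZr_LR. Qed.

Lemma innerDr x y z : ip x (y + z) = ip x y + ip x z.
Proof. by rewrite linearDr. Qed.

Lemma innerNl x y : ip (- x) y = - ip x y.
Proof. by rewrite -scaleN1r innerZl mulN1r. Qed.

Lemma innerNr x y : ip x (- y) = - ip x y.
Proof. by rewrite innerC innerNl rmorphN /= -innerC. Qed.

Lemma innerBl x y z : ip (x - y) z = ip x z - ip y z.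
Proof. by rewrite innerDl innerNl. Qed.

Lemma innerBr x y z : ip x (y - z) = ip x y - ip x z.
Proof. by rewrite innerDr innerNr. Qed.

Lemma inner0l y : ip 0 y = 0.
Proof. by rewrite -(scale0r (0 : H)) innerZl mul0r. Qed.

Lemma inner0r y : ip y 0 = 0.
Proof. by rewrite innerC inner0l rmorph0. Qed.

Lemma inner_suml (I : Type) (r : seq I) (F : I -> H) y :
  ip (\sum_(i <- r) F i) y = \sum_(i <- r) ip (F i) y.
Proof.
elim: r => [|i r IH]; first by rewrite !big_nil inner0l.
by rewrite !big_cons innerDl IH.
Qed.

Lemma inner_sumr (I : Type) (r : seq I) (F : I -> H) y :
  ip y (\sum_(i <- r) F i) = \sum_(i <- r) ip y (F i).
Proof.
elim: r => [|i r IH]; first by rewrite !big_nil inner0r.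
by rewrite !big_cons innerDr IH.
Qed.

(** The norm of [H] has values in R[i]; its real part brings estimates and limits back to R. *)
Definition hnorm x : R := complex.Re `|x|.

Lemma hnormE x : (hnorm x)%:C = `|x|.
Proof. by rewrite /hnorm RRe_real// ger0_real. Qed.

Lemma hnorm_ge0 x : 0 <= hnorm x.
Proof. by rewrite -ler0c hnormE. Qed.

Lemma hnormD x y : hnorm (x + y) <= hnorm x + hnorm y.
Proof. by rewrite -lecR (rmorphD (real_complex R)) /= !hnormE ler_normD. Qed.

Lemma hnormN x : hnorm (- x) = hnorm x.
Proof. by rewrite /hnorm normrN. Qed.

Lemma hdistC x y : hnorm (x - y) = hnorm (y - x).
Proof. by rewrite -hnormN opprB. Qed.

Lemma hnorm_eq0 x : hnorm x = 0 -> x = 0.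
Proof. by move=> x0; apply/normr0_eq0; rewrite -hnormE x0. Qed.

Lemma inner_self x : ip x x = (hnorm x ^+ 2)%:C.
Proof. by rewrite (rmorphXn (real_complex R)) /= hnormE inner_norm. Qed.

Lemma hnorm_sqr x : hnorm x ^+ 2 = complex.Re (ip x x).
Proof. by rewrite inner_self. Qed.

Lemma inner_CauchySchwarz x y : cabs (ip x y) <= hnorm x * hnorm y.
Proof.
have [y0|y0] := eqVneq (hnorm y) 0.
  by rewrite (hnorm_eq0 y0) inner0r (cabs_real 0) normr0 mulr_ge0// hnorm_ge0.
pose N := hnorm y ^+ 2.
have N0 : 0 < N by rewrite exprn_gt0// lt_neqAle eq_sym y0 hnorm_ge0.
pose c := ip x y.
have h : hnorm (N%:C *: x - c *: y) ^+ 2 = N * (N * hnorm x ^+ 2 - cabs c ^+ 2).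
  rewrite hnorm_sqr innerBl !innerBr !innerZl !innerZr !inner_self -/N (innerC x y) -/c.
  rewrite conjC_real cabs_sqr; case: c => a b /=; ring.
have : 0 <= N * hnorm x ^+ 2 - cabs c ^+ 2 by rewrite -(pmulr_rge0 _ N0) -h sqr_ge0.
rewrite subr_ge0 /N -exprMn ler_pXn2r ?nnegrE ?mulr_ge0 ?hnorm_ge0 ?cabs_ge0//.
by rewrite mulrC.
Qed.

Lemma hilbert_complete (u : nat -> H) (b : nat -> R) : b n @[n --> \oo] --> 0 ->
  (forall m n, (n <= m)%N -> hnorm (u m - u n) <= b n) ->
  exists x, hnorm (u n - x) @[n --> \oo] --> 0.
Proof.
move=> b0 ub.
have small (e : C) : 0 < e -> exists N, forall m, (N <= m)%N -> `|u N - u m| < e.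
  move=> e0; have e1 : 0 < complex.Re e by move: e0; rewrite ltcE => /andP[].
  move/cvgrPdist_lt : b0 => /(_ _ e1)[N _ /(_ N (leqnn N))] /=.
  rewrite sub0r normrN => bN; exists N => m Nm.
  rewrite -hnormE hdistC ltcE /=; apply/andP; split.
    by move: e0; rewrite ltcE eq_sym => /andP[].
  by apply: le_lt_trans (ub _ _ Nm) (le_lt_trans (ler_norm _) bN).
have : cvgn u.
  apply/cauchy_cvgP; apply: cauchy_exP => e /small[N uN].
  exists (u N); exists N => // m /= Nm.
  by rewrite -ball_normE /=; exact: uN.
move=> cu; exists (limn u); apply/cvgrPdist_le => e e0.
have eC : 0 < e%:C :> C by rewrite ltcE /= eqxx.
move/cvgrPdist_le : cu => /(_ _ eC); apply: filterS => n.
rewrite -hnormE lecR => h; rewrite sub0r normrN ger0_norm ?hnorm_ge0//.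
by rewrite hdistC.
Qed.

Lemma hlim_unique (u : nat -> H) x y : hnorm (u n - x) @[n --> \oo] --> 0 ->
  hnorm (u n - y) @[n --> \oo] --> 0 -> x = y.
Proof.
move=> ux uy; apply/eqP; rewrite -subr_eq0; apply/eqP; apply: hnorm_eq0.
apply/eqP; rewrite eq_le hnorm_ge0 andbT.
have c : hnorm (u n - x) + hnorm (u n - y) @[n --> \oo] --> 0.
  by rewrite -[X in _ --> X](addr0 0); exact: cvgD.
apply: (cvgr_to_ge c); apply: nearW => n.
by rewrite -(subrKA (u n)) (le_trans (hnormD _ _))// hdistC.
Qed.

Lemma inner_lim (u : nat -> H) x y : hnorm (u n - x) @[n --> \oo] --> 0 ->
  cabs (ip (u n) y - ip x y) @[n --> \oo] --> 0.
Proof.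
move=> ux; have c : hnorm (u n - x) * hnorm y @[n --> \oo] --> 0.
  by rewrite -[X in _ --> X](mul0r (hnorm y)); apply: cvgMr_tmp.
apply: (squeeze_cvgr _ (cvg_cst 0) c); apply: nearW => n.
by rewrite cabs_ge0 -innerBl inner_CauchySchwarz.
Qed.

End HilbertBasics.

Lemma climit_unique (R : realType) (c : nat -> R[i]) (a b : R[i]) :
  cabs (c n - a) @[n --> \oo] --> 0 -> cabs (c n - b) @[n --> \oo] --> 0 -> a = b.
Proof.
move=> ca cb; apply/eqP; rewrite -subr_eq0; apply/eqP; apply: cabs_eq0.
apply/eqP; rewrite eq_le cabs_ge0 andbT.
have c0 : cabs (c n - a) + cabs (c n - b) @[n --> \oo] --> 0.
  by rewrite -[X in _ --> X](addr0 0); exact: cvgD.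
apply: (cvgr_to_ge c0); apply: nearW => n.
rewrite -(subrKA (c n)) (le_trans (cabsD _ _))// lerD2r.
by rewrite /cabs distrC.
Qed.

Section OrthogonalSeries.
Variables (R : realType) (L : hilbertSpace R).
Notation C := R[i].
Notation ip := (inner L).

Lemma hnorm_sqrD (x y : L) : ip x y = 0 ->
  hnorm (x + y) ^+ 2 = hnorm x ^+ 2 + hnorm y ^+ 2.
Proof.
move=> xy; rewrite hnorm_sqr innerDl !innerDr xy (innerC x y) xy rmorph0 addr0 add0r.
by rewrite raddfD /= -!hnorm_sqr.
Qed.

Lemma hnormZ (a : C) (x : L) : hnorm (a *: x) = cabs a * hnorm x.
Proof.
apply: (@fmorph_inj _ _ (real_complex R)).
by rewrite (rmorphM (real_complex R)) /= !hnormE cabsE normrZ.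
Qed.

Variables (v : nat -> L) (K : R) (c : nat -> C) (B : R).
Hypothesis v_orth : forall i j, i != j -> ip (v i) (v j) = 0.
Hypothesis v_bounded : forall i, hnorm (v i) ^+ 2 <= K.

Lemma orth_sum_norm m n : hnorm (\sum_(m <= i < n) c i *: v i) ^+ 2 =
  \sum_(m <= i < n) cabs (c i) ^+ 2 * hnorm (v i) ^+ 2.
Proof.
elim: n => [|n IH]; first by rewrite !big_geq// /hnorm normr0 expr0n.
have [mn|nm] := leqP m n; last by rewrite !big_geq// /hnorm normr0 expr0n.
rewrite !big_nat_recr//= hnorm_sqrD; first by rewrite IH hnormZ exprMn.
rewrite innerZr inner_suml big_nat big1 ?mulr0// => i /andP[_ i_n].
by rewrite innerZl v_orth ?mulr0// (ltn_eqF i_n).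
Qed.

Lemma orth_sum_norm_le m n : hnorm (\sum_(m <= i < n) c i *: v i) ^+ 2 <=
  K * \sum_(m <= i < n) cabs (c i) ^+ 2.
Proof.
rewrite orth_sum_norm mulr_sumr; apply: ler_sum => i _.
by rewrite mulrC ler_wpM2r ?sqr_ge0.
Qed.

Hypothesis c_summable : forall n, \sum_(0 <= i < n) cabs (c i) ^+ 2 <= B.

(** The [v i] are only orthogonal and bounded, possibly 0, so that prescribed images of basis
    vectors can be inserted. *)
Lemma orth_series_cvg :
  exists x, hnorm (\sum_(0 <= i < n) c i *: v i - x) @[n --> \oo] --> 0.
Proof.
pose t n := \sum_(0 <= i < n) cabs (c i) ^+ 2.
have tmono : {homo t : m n / (m <= n)%N >-> m <= n}.
  by apply/nondecreasing_seqP => n; rewrite /t big_nat_recr//= lerDl sqr_ge0.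
have ct : cvgn t.
  by apply: nondecreasing_is_cvgn => //; exists B => _ [n _ <-]; exact: c_summable.
have tle n : t n <= limn t by exact: nondecreasing_cvgn_le.
have K0 : 0 <= K by apply: le_trans (v_bounded 0%N); exact: sqr_ge0.
have cb : Num.sqrt (K * (limn t - t n)) @[n --> \oo] --> 0.
  rewrite -[X in _ --> X]sqrtr0; apply: continuous_cvg; first exact: sqrt_continuous.
  rewrite -[X in _ --> X](mulr0 K); apply: cvgMl_tmp.
  by rewrite -[X in _ --> X](subrr (limn t)); apply: cvgB => //; exact: cvg_cst.
apply: (hilbert_complete cb) => m n nm.
rewrite (big_cat_nat (leq0n n) nm)//= addrAC subrr add0r -[leLHS]ger0_norm ?hnorm_ge0// -sqrtr_sqr.
rewrite ler_wsqrtr// (le_trans (orth_sum_norm_le _ _))// ler_wpM2l//.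
rewrite lerBrDr addrC; apply: le_trans (tle m).
by rewrite /t (big_cat_nat (leq0n n) nm).
Qed.

End OrthogonalSeries.

Section OrthonormalBasis.
Variables (R : realType) (H : hilbertSpace R).
Notation C := R[i].
Variable u : nat -> H.

Definition onb := (forall i j, inner H (u i) (u j) = (i == j)%:R) /\
  (forall f, (forall i, inner H f (u i) = 0) -> f = 0).

Hypothesis uB : onb.

Let fsum f n := \sum_(0 <= i < n) inner H f (u i) *: u i.

Lemma onb_norm i : hnorm (u i) = 1.
Proof.
apply/eqP; rewrite -(eqrXn2 (n := 2)) ?hnorm_ge0// hnorm_sqr uB.1 eqxx expr1n.
exact: eqxx.
Qed.

Let orth i j : i != j -> inner H (u i) (u j) = 0.
Proof. by move=> ij; rewrite uB.1 (negbTE ij). Qed.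

Lemma bessel f n : \sum_(0 <= i < n) cabs (inner H f (u i)) ^+ 2 <= hnorm f ^+ 2.
Proof.
have E : hnorm (fsum f n) ^+ 2 = \sum_(0 <= i < n) cabs (inner H f (u i)) ^+ 2.
  rewrite (orth_sum_norm _ orth); apply: eq_bigr => i _.
  by rewrite onb_norm expr1n mulr1.
rewrite -E -[f in leRHS](subrK (fsum f n)) hnorm_sqrD ?lerDr ?sqr_ge0//.
rewrite inner_sumr big_nat big1// => i /andP[_ i_n].
rewrite innerZr innerBl inner_suml [X in _ - X](bigD1_seq i) ?mem_index_iota ?iota_uniq//=.
rewrite innerZl uB.1 eqxx mulr1 big1 ?addr0 ?subrr ?mulr0// => j ji.
by rewrite innerZl uB.1 (negbTE ji) mulr0.
Qed.

Lemma fourier_cvg f : hnorm (fsum f n - f) @[n --> \oo] --> 0.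
Proof.
have norm1 i : hnorm (u i) ^+ 2 <= 1 by rewrite onb_norm expr1n.
have [s cs] := orth_series_cvg orth norm1 (bessel f).
suff sf : s = f by rewrite sf in cs.
apply/esym/eqP; rewrite -subr_eq0; apply/eqP; apply: uB.2 => i.
rewrite innerBl; apply/eqP; rewrite subr_eq0; apply/eqP.
apply: (climit_unique _ (inner_lim (u i) cs)).
have c0 : (0 : R) @[n --> \oo] --> (0 : R) by exact: cvg_cst.
apply: cvg_trans c0; apply: near_eq_cvg; exists i.+1 => // n /= i_n.
rewrite inner_suml (bigD1_seq i) ?mem_index_iota ?iota_uniq//=.
rewrite innerZl uB.1 eqxx mulr1 big1 ?addr0 ?subrr ?(cabs_real 0) ?normr0// => j ji.
by rewrite innerZl uB.1 (negbTE ji) mulr0.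
Qed.

Lemma onb_functional_ext (phi : H -> C) (K : R) :
  (forall a x y, phi (a *: x + y) = a * phi x + phi y) ->
  (forall x, cabs (phi x) <= K * hnorm x) ->
  (forall i, phi (u i) = 0) -> forall f, phi f = 0.
Proof.
move=> lin bnd phi0 f.
have phiD x y : phi (x + y) = phi x + phi y by have := lin 1 x y; rewrite scale1r mul1r.
have p0 : phi 0 = 0 by apply: (@addrI _ (phi 0)); rewrite -phiD !addr0.
have sum0 n : phi (fsum f n) = 0.
  elim: n => [|n IH]; first by rewrite /fsum big_geq.
  by rewrite /fsum big_nat_recr//= addrC lin phi0 mulr0 add0r.
have phiN x : phi (- x) = - phi x.
  by apply: (@addrI _ (phi x)); rewrite -phiD !subrr.
apply: cabs_eq0; apply/eqP; rewrite eq_le cabs_ge0 andbT.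
have c0 : K * hnorm (fsum f n - f) @[n --> \oo] --> 0.
  by rewrite -[X in _ --> X](mulr0 K); apply: cvgMl_tmp; exact: fourier_cvg.
apply: (cvgr_to_ge c0); apply: nearW => n.
apply: le_trans (bnd _); rewrite phiD sum0 add0r phiN.
by rewrite cabsN.
Qed.

Section Operators.
Variable L : hilbertSpace R.

Lemma mk_linear (f : H -> L) : (forall a x y, f (a *: x + y) = a *: f x + f y) ->
  exists T : {linear H -> L}, forall x, T x = f x.
Proof.
move=> lin; pose mx := GRing.isLinear.Build C H L *:%R f lin.
by exists (HB.pack f mx : {linear H -> L}).
Qed.

Definition hbounded (T : H -> L) K := forall x, hnorm (T x) <= K * hnorm x.

Lemma hbounded_bounded (T : {linear H -> L}) K : hbounded T K -> bounded_operator T.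
Proof.
move=> TK; exists K => x; rewrite -!hnormE -(rmorphM (real_complex R)) lecR.
exact: TK.
Qed.

Lemma bounded_hbounded (T : {linear H -> L}) : bounded_operator T -> exists K, hbounded T K.
Proof.
by move=> [K TK]; exists K => x; rewrite -lecR (rmorphM (real_complex R)) /= !hnormE.
Qed.

Lemma onb_operator_ext (S T : {linear H -> L}) KS KT : hbounded S KS -> hbounded T KT ->
  (forall i, S (u i) = T (u i)) -> forall x, S x = T x.
Proof.
move=> bS bT ST x; apply/eqP; rewrite -subr_eq0; apply/eqP.
apply: hnorm_eq0; apply/eqP; rewrite -sqrf_eq0 hnorm_sqr.
pose z := S x - T x; rewrite -/z.
rewrite (_ : inner L z z = 0)//.
apply: (@onb_functional_ext (fun x => inner L (S x - T x) z) ((KS + KT) * hnorm z)).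
- move=> a y y'; rewrite !innerBl (linearD S) (linearD T) (linearZ_LR S) (linearZ_LR T).
  by rewrite !innerDl !innerZl; ring.
- move=> y; apply: le_trans (inner_CauchySchwarz _ _) _.
  rewrite mulrAC ler_wpM2r ?hnorm_ge0// (le_trans (hnormD _ _))// hnormN mulrDl.
  exact: lerD.
- by move=> i; rewrite ST subrr inner0l.
Qed.

Lemma onb_operator (w : nat -> L) (K : R) : 0 <= K ->
  (forall i j, i != j -> inner L (w i) (w j) = 0) ->
  (forall i, hnorm (w i) ^+ 2 <= K ^+ 2) ->
  exists T : {linear H -> L}, hbounded T K /\ forall i, T (u i) = w i.
Proof.
move=> K0 worth wK.
pose s f n := \sum_(0 <= i < n) inner H f (u i) *: w i.
have cs f : exists x, hnorm (s f n - x) @[n --> \oo] --> 0.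
  exact: (orth_series_cvg worth wK (bessel f)).
pose T f := projT1 (cid (cs f)).
have cT f : hnorm (s f n - T f) @[n --> \oo] --> 0 := projT2 (cid (cs f)).
have lin a x y : T (a *: x + y) = a *: T x + T y.
  apply: (hlim_unique (cT _)).
  have c0 : cabs a * hnorm (s x n - T x) + hnorm (s y n - T y) @[n --> \oo] --> 0.
    by rewrite -[X in _ --> X]addr0 -[X in _ --> X + _](mulr0 (cabs a));
       apply: cvgD => //; apply: cvgMl_tmp.
  apply: (squeeze_cvgr _ (cvg_cst 0) c0); apply: nearW => n.
  rewrite hnorm_ge0 -hnormZ /=.
  have -> : s (a *: x + y) n - (a *: T x + T y) = a *: (s x n - T x) + (s y n - T y).
    rewrite scalerBr addrACA -opprD; congr (_ - _).
    rewrite scaler_sumr -big_split; apply: eq_bigr => i _ /=.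
    by rewrite innerDl innerZl scalerDl scalerA.
  exact: hnormD.
have [T' TE] := mk_linear lin; exists T'; split.
  move=> x; rewrite TE.
  have c0 : hnorm (s x n - T x) + K * hnorm x @[n --> \oo] --> K * hnorm x.
    by rewrite -[X in _ --> X]add0r; apply: cvgD => //; exact: cvg_cst.
  apply: (cvgr_to_ge c0); apply: nearW => n.
  rewrite -{1}(subKr (s x n) (T x)) addrC (le_trans (hnormD _ _))// hnormN.
  rewrite lerD2l -(ler_pXn2r (n := 2)) ?nnegrE ?mulr_ge0 ?hnorm_ge0//.
  rewrite (le_trans (orth_sum_norm_le _ worth wK _ _))// exprMn.
  by rewrite ler_wpM2l ?sqr_ge0// bessel.
move=> i; rewrite TE; apply: (hlim_unique (cT _)).
have c0 : (0 : R) @[n --> \oo] --> (0 : R) by exact: cvg_cst.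
apply: cvg_trans c0; apply: near_eq_cvg; exists i.+1 => // n /= i_n.
rewrite /s (bigD1_seq i) ?mem_index_iota ?iota_uniq//= uB.1 eqxx scale1r.
rewrite big1 ?addr0 ?subrr ?/hnorm ?normr0// => j ji.
by rewrite uB.1 eq_sym (negbTE ji) scale0r.
Qed.

Lemma onb_isometry (J : {linear H -> L}) K : hbounded J K ->
  (forall i j, inner L (J (u i)) (J (u j)) = (i == j)%:R) ->
  isometry (inner L) (inner H) J.
Proof.
move=> JK Ju f g.
have step (z : H) (h : L) : (forall i, inner L (J (u i)) h = inner H (u i) z) ->
    forall x, inner L (J x) h = inner H x z.
  move=> hz x; apply/eqP; rewrite -subr_eq0; apply/eqP.
  apply: (@onb_functional_ext (fun x => inner L (J x) h - inner H x z)
    (K * hnorm h + hnorm z)).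
  - by move=> a y y'; rewrite (linearD J) (linearZ_LR J) !innerDl !innerZl; ring.
  - move=> y; apply: le_trans (cabsD _ _) _.
    rewrite mulrDl; apply: lerD.
      apply: le_trans (inner_CauchySchwarz _ _) _.
      by rewrite mulrAC ler_wpM2r ?hnorm_ge0.
    rewrite cabsN mulrC; exact: inner_CauchySchwarz.
  - by move=> i; rewrite hz subrr.
apply: (step g (J g)) => i; rewrite innerC [RHS]innerC; congr (_^*).
by apply: (step (u i)) => j; rewrite Ju uB.1.
Qed.

End Operators.

Lemma onb_adjoint (S T : {linear H -> H}) KS KT : hbounded S KS -> hbounded T KT ->
  (forall i j, inner H (S (u i)) (u j) = inner H (u i) (T (u j))) -> is_adjoint S T.
Proof.
move=> bS bT ST x y.
have bnd (f g h k : H) : cabs (inner H f g - inner H h k) <= hnorm f * hnorm g + hnorm h * hnorm k.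
  apply: le_trans (cabsD _ _) _; apply: lerD; first exact: inner_CauchySchwarz.
  by rewrite cabsN; exact: inner_CauchySchwarz.
have half j z : inner H (S z) (u j) = inner H z (T (u j)).
  apply/eqP; rewrite -subr_eq0; apply/eqP.
  apply: (@onb_functional_ext (fun z => inner H (S z) (u j) - inner H z (T (u j)))
    (KS * hnorm (u j) + hnorm (T (u j)))).
  - by move=> a f g; rewrite (linearD S) (linearZ_LR S) !innerDl !innerZl; ring.
  - move=> f; apply: le_trans (bnd _ _ _ _) _; rewrite mulrDl [hnorm f * _]mulrC.
    by rewrite lerD2r mulrAC ler_wpM2r ?hnorm_ge0.
  - by move=> i; rewrite ST subrr.
rewrite innerC [RHS]innerC; congr (_^*).
apply/eqP; rewrite -subr_eq0; apply/eqP.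
apply: (@onb_functional_ext (fun y => inner H y (S x) - inner H (T y) x)
  (hnorm (S x) + KT * hnorm x)).
- by move=> a f g; rewrite (linearD T) (linearZ_LR T) !innerDl !innerZl; ring.
- move=> f; apply: le_trans (bnd _ _ _ _) _; rewrite mulrDl [hnorm f * _]mulrC.
  by rewrite lerD2l mulrAC ler_wpM2r ?hnorm_ge0.
- by move=> j; rewrite innerC half -innerC subrr.
Qed.

End OrthonormalBasis.

(** * Subnormality and moments *)

Section SubnormalDifferences.
Variables (R : realType) (H : hilbertSpace R) (T : {linear H -> H}).
Hypothesis subT : subnormal T.

Lemma subnormal_fdiff_ge0 (x : H) (B : R) : (forall n, hnorm (iter n T x) <= B) ->
  forall n, 0 <= fdiff (fun k => hnorm (iter k T x) ^+ 2) n 0.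
Proof.
move=> xB; case: subT => _ [L [J [N [Jiso _ [S [_ NS comm]] NJ]]]].
pose v := J x.
have iterN n : iter n N v = J (iter n T x) by elim: n => //= n ->; rewrite NJ.
have Jnorm y : hnorm (J y) = hnorm y.
  apply/eqP; rewrite -(eqrXn2 (n := 2)) ?hnorm_ge0// !hnorm_sqr.
  by rewrite (Jiso y y).
have SN y z : inner L (S y) z = inner L y (N z).
  by rewrite innerC -NS -innerC.
have normS y : hnorm (S y) = hnorm (N y).
  apply/eqP; rewrite -(eqrXn2 (n := 2)) ?hnorm_ge0// !hnorm_sqr.
  by rewrite SN comm -NS.
pose D y := y - S (N y).
have DN y : D (N y) = N (D y) by rewrite /D (linearB N) comm.
have iterDN n y : iter n D (N y) = N (iter n D y) by elim: n => //= n ->; rewrite DN.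
have Dsym y z : inner L (D y) z = inner L y (D z).
  by rewrite /D innerBl innerBr SN -NS.
have iterDsym n y z : inner L (iter n D y) z = inner L y (iter n D z).
  by elim: n y z => //= n IH y z; rewrite Dsym IH -iterS -iterSr.
have fdE n j : fdiff (fun k => hnorm (iter k T x) ^+ 2) n j =
    complex.Re (inner L (iter n D (iter j N v)) (iter j N v)).
  elim: n j => [|n IH] j; first by rewrite /= -hnorm_sqr iterN Jnorm.
  rewrite /= !IH -raddfB; congr (complex.Re _); rewrite [iter j.+1 N v]/=.
  set y := iter j N v; rewrite -[D (iter n D y)]/(iter n D y - S (N (iter n D y))).
  by rewrite innerBl SN iterDN.
have bounded k : exists K, forall n, hnorm (iter n N (iter k D v)) <= K.
  elim: k => [|k [K hK]]; first by exists B => n; rewrite iterN Jnorm.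
  exists (K + K) => n /=; set y := iter k D v.
  have -> : iter n N (D y) = iter n N y - S (iter n.+1 N y).
    rewrite iterSr /D; elim: n => //= n ->.
    by rewrite (linearB N) comm.
  by rewrite (le_trans (hnormD _ _))// hnormN normS lerD// -iterS.
(* Half of the self-adjoint factors [D] move to the other side. For odd n there remains <D w, w> =
   |w|^2 - |N w|^2, and |N w| <= |w| because |N^j w|^2 is log-convex and bounded in j. *)
move=> n; rewrite fdE /= -[n]odd_double_half addnC -addnn -addnA iterD.
rewrite iterDsym; set w := iter n./2 D v.
case: (odd n); last by rewrite addn0 -hnorm_sqr sqr_ge0.
rewrite addn1 /= -/w Dsym /D innerBr -NS raddfB /= -!hnorm_sqr subr_ge0.
have [K wK] := bounded n./2.
pose s j := hnorm (iter j N w) ^+ 2.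
apply: (@log_convex_bounded _ s (K ^+ 2)).
- by move=> j; exact: sqr_ge0.
- move=> j; rewrite /s !iterS; set y := iter j N w.
  rewrite -exprMn ler_pXn2r ?nnegrE ?mulr_ge0 ?sqr_ge0 ?hnorm_ge0//.
  rewrite hnorm_sqr NS (le_trans (ler_norm _))// (le_trans (ler_cabs_Re _))//.
  by rewrite (le_trans (inner_CauchySchwarz _ _))// normS.
- by move=> j; rewrite ler_pXn2r ?nnegrE ?hnorm_ge0// (le_trans (hnorm_ge0 w) (wK 0%N)).
Qed.

End SubnormalDifferences.

(** * The normal extension built from a Jacobi matrix *)

Section NormalExtension.
Variables (R : realType) (H : hilbertSpace R) (u : nat -> H).
Hypothesis uB : onb u.
Notation C := R[i].
Notation ip := (inner H).

(* The x (k, n) play the role of the basis of l^2(Z) (x) l^2(N); the other basis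
   vectors of H are sent to 0 by the operators below. *)
Let x (i : int * nat) : H := u (pickle i).

Let xx i j : ip (x i) (x j) = (i == j)%:R.
Proof. by rewrite /x uB.1 (inj_eq (pcan_inj pickleK)). Qed.

Lemma family_operator (w : int * nat -> H) :
  (forall i j, i != j -> ip (w i) (w j) = 0) -> (forall i, hnorm (w i) <= 1) ->
  exists T : {linear H -> H}, [/\ hbounded T 1, forall i, T (x i) = w i &
    forall n, pickle_inv n = None :> option (int * nat) -> T (u n) = 0].
Proof.
move=> worth w1.
pose w' n := if pickle_inv n is Some i then w i else 0.
have [||T [T1 Tw]] := @onb_operator R H u uB H w' 1 ler01.
- move=> m n mn; rewrite /w'; case Em: (pickle_inv m) => [i|]; last by rewrite inner0l.
  case En: (pickle_inv n) => [j|]; last by rewrite inner0r.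
  apply: worth; apply: contra mn => /eqP ij.
  have := @pickle_invK (int * nat)%type m; have := @pickle_invK (int * nat)%type n.
  by rewrite Em En /= ij => <- <-.
- move=> n; rewrite expr1n /w'; case: (pickle_inv n) => [i|].
    by rewrite expr_le1 ?hnorm_ge0.
  by rewrite /hnorm normr0 expr0n.
exists T; split=> // [i|n En]; first by rewrite /x Tw /w' pickleK_inv.
by rewrite Tw /w' En.
Qed.

Variable b : nat -> R.
Hypotheses (b0 : forall n, 0 <= b n) (b1 : forall n, b n <= 1).

Let low (l : int) n : H := if n is n'.+1 then (b n')%:C *: x (l, n') else 0.

(** d = 1 gives U (x) A and d = -1 its adjoint. Raising and lowering parts are built separately,
    because each sends the basis to an orthogonal family, which their sum need not do. *)
Lemma jacobi_shift (d : int) : exists T : {linear H -> H}, [/\ hbounded T 2,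
  forall k n, T (x (k, n)) = (b n)%:C *: x (k + d, n.+1) + low (k + d) n &
  forall n, pickle_inv n = None :> option (int * nat) -> T (u n) = 0].
Proof.
have hx i n : hnorm ((b n)%:C *: x i) <= 1.
  by rewrite hnormZ cabs_real /x (onb_norm uB) mulr1 ger0_norm.
have [||T1 [T1b T1x T1u]] := @family_operator (fun i => (b i.2)%:C *: x (i.1 + d, i.2.+1)).
- move=> [k n] [l m] ij /=; rewrite innerZl innerZr xx.
  by rewrite xpair_eqE eqSS (inj_eq (addIr d)) -xpair_eqE (negbTE ij) !mulr0.
- by move=> [k n] /=.
have [||T2 [T2b T2x T2u]] := @family_operator (fun i => low (i.1 + d) i.2).
- move=> [k [|n]] [l [|m]] ij /=; rewrite ?inner0l ?inner0r// innerZl innerZr xx.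
  by rewrite xpair_eqE -eqSS (inj_eq (addIr d)) -xpair_eqE (negbTE ij) !mulr0.
- by move=> [k [|n]] //=; rewrite /hnorm normr0.
exists (T1 \+ T2); split.
- move=> f /=; apply: le_trans (hnormD _ _) _.
  by rewrite (_ : 2 = 1 + 1)// mulrDl lerD.
- by move=> k n /=; rewrite T1x T2x.
- by move=> n En /=; rewrite T1u// T2u// addr0.
Qed.


Let is_shift (T : {linear H -> H}) (d : int) := [/\ hbounded T 2,
  forall k n, T (x (k, n)) = (b n)%:C *: x (k + d, n.+1) + low (k + d) n &
  forall n, pickle_inv n = None :> option (int * nat) -> T (u n) = 0].

Lemma shift_commute (S T : {linear H -> H}) c d : is_shift S c -> is_shift T d ->
  forall f, S (T f) = T (S f).
Proof.
move=> [Sb Sx Su] [Tb Tx Tu] f.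
have lowE (V : {linear H -> H}) e : is_shift V e -> forall k n,
    V (low k n) = if n is n'.+1 then
      (b n')%:C *: ((b n')%:C *: x (k + e, n) + low (k + e) n') else 0.
  by move=> [_ Vx _] k [|n] /=; rewrite ?linear0// linearZ_LR Vx.
apply: (@onb_operator_ext R H u uB H (S \o T) (T \o S) (2 * 2) (2 * 2)) => {f}.
- move=> f /=; apply: le_trans (Sb _) _; rewrite -mulrA ler_pM2l//; exact: Tb.
- move=> f /=; apply: le_trans (Tb _) _; rewrite -mulrA ler_pM2l//; exact: Sb.
- move=> i /=; case Ei: (pickle_inv i : option (int * nat)) => [[k n]|]; last first.
    by rewrite Tu// Su// !linear0.
  have := @pickle_invK (int * nat)%type i; rewrite Ei /= => <-; rewrite -/(x (k, n)).
  rewrite Tx Sx (linearD S) (linearD T) (linearZ_LR S) (linearZ_LR T) Sx Tx.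
  by rewrite (lowE S c)// (lowE T d)// [k + d + c]addrAC.
Qed.

Lemma shift_adjoint (S T : {linear H -> H}) d : is_shift S d -> is_shift T (- d) ->
  is_adjoint S T.
Proof.
move=> [Sb Sx Su] [Tb Tx Tu]; apply: (onb_adjoint uB Sb Tb) => i j.
have lowl l k a : ip (low l k) (x a) = if k is k'.+1 then (b k')%:C * ((l, k') == a)%:R else 0.
  by case: k => [|k] /=; rewrite ?inner0l// innerZl xx.
have lowr l k a : ip (x a) (low l k) = if k is k'.+1 then (b k')%:C * (a == (l, k'))%:R else 0.
  by case: k => [|k] /=; rewrite ?inner0r// innerZr conjC_real xx.
case Ei: (pickle_inv i : option (int * nat)) => [[k n]|]; last first.
  rewrite Su// inner0l.
  have ui a : ip (u i) (x a) = 0.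
    rewrite /x uB.1; case: eqP => // ia; move: Ei; rewrite ia.
    by rewrite (pickleK_inv a).
  case Ej: (pickle_inv j : option (int * nat)) => [[l m]|]; last by rewrite Tu// inner0r.
  have := @pickle_invK (int * nat)%type j; rewrite Ej /= => <-; rewrite -/(x (l, m)).
  rewrite Tx innerDr innerZr ui mulr0 add0r.
  by case: m {Ej} => [|m] /=; rewrite ?inner0r// innerZr ui mulr0.
have := @pickle_invK (int * nat)%type i; rewrite Ei /= => <-; rewrite -/(x (k, n)).
case Ej: (pickle_inv j : option (int * nat)) => [[l m]|]; last first.
  rewrite Tu// inner0r.
  have uj a : ip (x a) (u j) = 0.
    rewrite /x uB.1; case: eqP => // ja; move: Ej; rewrite -ja.
    by rewrite (pickleK_inv a).
  rewrite Sx innerDl innerZl uj mulr0 add0r.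
  by case: n {Ei} => [|n] /=; rewrite ?inner0l// innerZl uj mulr0.
have := @pickle_invK (int * nat)%type j; rewrite Ej /= => <-; rewrite -/(x (l, m)).
rewrite Sx Tx innerDl innerDr innerZl innerZr conjC_real !xx lowl lowr.
have e : (k == l - d) = (k + d == l) by rewrite eq_sym subr_eq eq_sym.
have bE (p q : nat) (c : bool) : (b p)%:C * (c && (p == q))%:R = (b q)%:C * (c && (p == q))%:R.
  by case: eqP => [->//|_]; rewrite andbF !mulr0.
case: n {Ei} => [|n]; case: m {Ej} => [|m] /=;
  rewrite !xpair_eqE e ?eqSS ?andbF ?mulr0 ?addr0 ?add0r//.
by rewrite (bE n.+1) (bE n) addrC.
Qed.

(** The Jacobi matrix applied to the coordinate sequence [al]. *)
Definition tri (al : nat -> R) k : R :=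
  b k * al k.+1 + (if k is k'.+1 then b k' * al k' else 0).

(** Moving [S] to the other side as its adjoint [T] expresses the new coordinates through the old:
    the level c becomes c + d, and A acts within it. *)
Lemma shift_coef (S T : {linear H -> H}) d c (al : nat -> R) y : is_shift S d ->
  is_shift T (- d) ->
  (forall l k, ip y (x (l, k)) = ((l == c)%:R * al k)%:C) ->
  forall l k, ip (S y) (x (l, k)) = ((l == c + d)%:R * tri al k)%:C.
Proof.
move=> Ssh Tsh yE l k; have [_ Tx _] := Tsh.
rewrite (shift_adjoint Ssh Tsh) Tx innerDr innerZr conjC_real yE subr_eq.
have -> : ip y (low (l - d) k) =
    ((l == c + d)%:R * (if k is k'.+1 then b k' * al k' else 0))%:C.
  case: k => [|k] /=; first by rewrite inner0r mulr0.
  rewrite innerZr conjC_real yE subr_eq -(rmorphM (real_complex R)).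
  by rewrite mulrCA.
rewrite -(rmorphM (real_complex R)) -(rmorphD (real_complex R)) /tri.
by rewrite [in RHS]mulrDr [in RHS]mulrCA.
Qed.

Variable A : nat -> nat -> R.
Hypothesis A0 : forall k, A 0%N k = (k == 0%N)%:R.
Hypothesis AS : forall n k, A n.+1 k = tri (A n) k.

Lemma jacobi_subnormal (M : {linear H -> H}) (mom : nat -> R) :
  (forall n, 0 < mom n) -> (forall n, A n.*2 0%N = mom n / mom 0%N) ->
  bounded_operator M ->
  (forall n, M (u n) = (Num.sqrt (mom n.+1 / mom n))%:C *: u n.+1) -> subnormal M.
Proof.
move=> mom0 AE Mb Mu; split=> //.
have [N Nsh] := jacobi_shift 1; have [S Ssh] := jacobi_shift (- 1).
have Nsh' : is_shift N (- - 1) by rewrite opprK.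
have NS := shift_adjoint Nsh Ssh.
pose y0 := x (0, 0%N).
have Ncoef n l k : ip (iter n N y0) (x (l, k)) = ((l == n%:Z)%:R * A n k)%:C.
  elim: n l k => [|n IH] l k.
    by rewrite /= xx xpair_eqE A0 eq_sym [_ == k]eq_sym -natrM mulnb (rmorph_nat (real_complex R)).
  by rewrite iterS (shift_coef Nsh Ssh IH) AS -addn1 PoszD.
have NScoef m n l k : ip (iter m S (iter n N y0)) (x (l, k)) =
    ((l == n%:Z - m%:Z)%:R * A (m + n)%N k)%:C.
  elim: m l k => [|m IH] l k; first by rewrite subr0 Ncoef.
  by rewrite iterS (shift_coef Ssh Nsh' IH) addSn AS -addn1 PoszD opprD addrA.
have SN f g : ip (S f) g = ip f (N g) by rewrite innerC -NS -innerC.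
have iterSN m f g : ip (iter m S f) g = ip f (iter m N g).
  by elim: m f g => // m IH f g; rewrite iterSr IH SN.
(* Taking N^m to the left as S^m gives a vector of level n - m, paired with level 0. So U provides
   the orthogonality for n != m, and A^(2n) the norms. *)
have NN n m : ip (iter n N y0) (iter m N y0) = ((n == m)%:R * (mom n / mom 0%N))%:C.
  rewrite -iterSN /y0 NScoef [0 == _]eq_sym subr_eq0 eqz_nat.
  case: eqP => [<-|_]; last by rewrite !mul0r.
  by rewrite addnn AE.
pose v n := (Num.sqrt (mom 0%N / mom n))%:C *: iter n N y0.
have vv n m : ip (v n) (v m) = (n == m)%:R.
  rewrite innerZl innerZr conjC_real NN -!(rmorphM (real_complex R)) /=.
  case: eqP => [<-|_]; last by rewrite mul0r !mulr0.
  rewrite mul1r mulrA -expr2 sqr_sqrtr ?divr_ge0 ?ltW//.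
  by rewrite mulrA divfK ?gt_eqF// divff ?gt_eqF.
have [||J [Jb Ju]] := @onb_operator R H u uB H v 1 ler01.
- by move=> i j ij; rewrite vv (negbTE ij).
- by move=> i; rewrite hnorm_sqr vv eqxx expr1n.
have [Nb _ _] := Nsh; have [Sb _ _] := Ssh.
exists H, J, N; split.
- by apply: (onb_isometry uB Jb) => i j; rewrite !Ju vv.
- exact: hbounded_bounded Nb.
- exists S; split=> //; first exact: hbounded_bounded Sb.
  exact: shift_commute Nsh Ssh.
have [K MK] := bounded_hbounded Mb.
apply: (@onb_operator_ext R H u uB H (N \o J) (J \o M) (2 * 1) (1 * K)).
- by move=> f /=; apply: le_trans (Nb _) _; rewrite -mulrA ler_pM2l.
- by move=> f /=; apply: le_trans (Jb _) _; rewrite !mul1r.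
- move=> n /=; rewrite Mu (linearZ_LR J) !Ju (linearZ_LR N) scalerA -(rmorphM (real_complex R)).
  congr (_%:C *: _); rewrite -sqrtrM ?divr_ge0 ?ltW//; congr (Num.sqrt _).
  by field; rewrite !gt_eqF.
Qed.

End NormalExtension.

(** * The reproducing kernel space *)

Section KernelSeries.
Variable R : realType.
Notation C := R[i].

Lemma geometric_sum_le (s : R) n : 0 <= s -> s < 1 ->
  \sum_(0 <= k < n) s ^+ k <= (1 - s)^-1.
Proof.
move=> s0 s1; have d0 : 0 < 1 - s by rewrite subr_gt0.
rewrite -[leRHS]mul1r ler_pdivlMr// mulrC.
suff -> : (1 - s) * \sum_(0 <= k < n) s ^+ k = 1 - s ^+ n by rewrite gerBl exprn_ge0.
elim: n => [|n IH]; first by rewrite big_geq// mulr0 subrr.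
by rewrite big_nat_recr//= mulrDr IH exprS; ring.
Qed.

Lemma powR_sum_bounded (q r : R) : 0 < q -> 0 <= r -> r < 1 ->
  exists B, forall n, \sum_(0 <= k < n) k.+1%:R `^ q * r ^+ k <= B.
Proof.
move=> q0 r0 r1.
have d0 : 0 < 1 + r by rewrite ltr_wpDr.
(* This s satisfies s > 1 and s r < 1. Raising (k + 1) d <= exp ((k + 1) d), d = ln s / q, to the
   power q yields (k + 1)^q <= d^(-q) s^(k+1), a geometric majorant. *)
pose s := 2 / (1 + r); have s1 : 1 < s by rewrite ltr_pdivlMr// mul1r; lra.
have s0 := lt_trans ltr01 s1.
have sr1 : s * r < 1 by rewrite mulrAC ltr_pdivrMr// mul1r; lra.
have sr0 : 0 <= s * r by rewrite mulr_ge0// ltW.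
pose d := ln s / q; have dgt0 : 0 < d by rewrite divr_gt0// ln_gt0.
have term k : k.+1%:R `^ q <= d `^ (- q) * s * s ^+ k.
  have kd0 : 0 <= k.+1%:R * d by rewrite mulr_ge0// ltW.
  have h : k.+1%:R * d <= expR (k.+1%:R * d).
    by apply: le_trans (expR_ge1Dx _); rewrite lerDr.
  have := ge0_ler_powR (ltW q0) _ _ h; rewrite !nnegrE kd0 expR_ge0 => /(_ isT isT).
  rewrite powRM ?(ltW dgt0)// -expRM -mulrA divfK ?gt_eqF// expRM_natl lnK ?posrE//.
  rewrite -ler_pdivlMr ?powR_gt0// => /le_trans; apply.
  by rewrite powRN exprS [leLHS]mulrC mulrA.
exists (d `^ (- q) * s * (1 - s * r)^-1) => n.
apply: (@le_trans _ _ (d `^ (- q) * s * \sum_(0 <= k < n) (s * r) ^+ k)).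
  rewrite mulr_sumr; apply: ler_sum => k _.
  by rewrite exprMn [leRHS]mulrA ler_wpM2r ?exprn_ge0.
apply: ler_wpM2l; last exact: geometric_sum_le.
by apply: mulr_ge0; [exact: powR_ge0 | exact: ltW].
Qed.

Lemma complex_series_cvg (z : nat -> C) (B : R) :
  (forall n, \sum_(0 <= k < n) cabs (z k) <= B) ->
  exists l, cabs (\sum_(0 <= k < n) z k - l) @[n --> \oo] --> 0.
Proof.
move=> zB.
have real_part (h : C -> R) : (forall w, `|h w| <= cabs w) ->
    cvgn (fun n => \sum_(0 <= k < n) h (z k)).
  move=> hc; rewrite (_ : (fun n => _) = series (fun k => h (z k))); last first.
    by apply/funext => n; rewrite seriesEnat.
  apply: normed_cvg; apply: nondecreasing_is_cvgn.
    by apply/nondecreasing_seqP => n;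
      rewrite /normed_series_of !seriesEnat /= big_nat_recr//= lerDl.
  exists B => _ [n _ <-]; rewrite /normed_series_of seriesEnat /=.
  by apply: le_trans (zB n); apply: ler_sum.
have cRe := real_part _ (@ler_cabs_Re R).
have cIm := real_part _ (@ler_cabs_Im R).
exists (Complex (limn (fun n => \sum_(0 <= k < n) complex.Re (z k)))
  (limn (fun n => \sum_(0 <= k < n) complex.Im (z k)))).
set a := limn _; set b := limn _.
have c0 : `|\sum_(0 <= k < n) complex.Re (z k) - a| +
    `|\sum_(0 <= k < n) complex.Im (z k) - b| @[n --> \oo] --> 0.
  rewrite -[X in _ --> X](addr0 0); apply: cvgD; rewrite -[X in _ --> X](normr0 R);
  apply: cvg_norm.
    by apply/subr_cvg0.
  by apply/subr_cvg0.
apply: (squeeze_cvgr _ (cvg_cst 0) c0); apply: nearW => n; rewrite cabs_ge0 /=.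
have -> : \sum_(0 <= k < n) z k - Complex a b =
    (\sum_(0 <= k < n) complex.Re (z k) - a)%:C +
    Complex 0 1 * (\sum_(0 <= k < n) complex.Im (z k) - b)%:C.
  apply/eqP; rewrite eq_complex /= !raddfB /= !raddf_sum /=; apply/andP; split; apply/eqP; ring.
apply: le_trans (cabsD _ _) _; rewrite cabsM !cabs_real lerD2l.
rewrite (_ : cabs _ = 1) ?mul1r//.
by rewrite /cabs normc_def /= expr0n expr1n add0r sqrtr1.
Qed.

Lemma limn_complex (s : nat -> C) l : cabs (s n - l) @[n --> \oo] --> 0 ->
  limn (s : nat -> C^o) = l.
Proof.
move=> sl; apply: (@cvg_lim C^o); first exact: norm_hausdorff.
apply/cvgrPdist_le => e e0.
have e1 : 0 < complex.Re e by move: e0; rewrite ltcE => /andP[].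
move/cvgrPdist_le : sl => /(_ _ e1); apply: filterS => n.
rewrite sub0r normrN ger0_norm ?cabs_ge0// => h.
rewrite distrC -[`|_|]cabsE lecE /= h andbT.
by move: e0; rewrite ltcE eq_sym => /andP[].
Qed.

Variable p : R.
Hypothesis p0 : 0 < p.
Notation a := (kcoef p).
Notation K z w := (Kp p z w + Kp (p + 2) z w).

Lemma Kp_cvg (q : R) z w : 0 < q -> cabs (z * w^*) < 1 ->
  cabs (\sum_(0 <= k < n) (k.+1%:R `^ q)%:C * (z * w^*) ^+ k - Kp q z w) @[n --> \oo] --> 0.
Proof.
move=> q0 zw; set t := z * w^* in zw *.
have [B hB] := powR_sum_bounded q0 (cabs_ge0 t) zw.
have [|l cl] := @complex_series_cvg (fun k => (k.+1%:R `^ q)%:C * t ^+ k) B.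
  move=> n; apply: le_trans (hB n); apply: ler_sum => k _.
  by rewrite cabsM cabs_real cabsX ger0_norm// powR_ge0.
suff -> : Kp q z w = l by [].
rewrite /Kp; apply: limn_complex.
rewrite (_ : (fun n => _) = (fun n => cabs (\sum_(0 <= k < n) (k.+1%:R `^ q)%:C * t ^+ k - l)))//.
Qed.

Lemma kernel_cvg z w : cabs (z * w^*) < 1 ->
  cabs (\sum_(0 <= k < n) (a k)%:C * (z * w^*) ^+ k - K z w) @[n --> \oo] --> 0.
Proof.
move=> zw; have p2 : 0 < p + 2 by rewrite addr_gt0.
pose s (q : R) n : C := \sum_(0 <= k < n) (k.+1%:R `^ q)%:C * (z * w^*) ^+ k.
have c1 : cabs (s p n - Kp p z w) @[n --> \oo] --> 0 := Kp_cvg p0 zw.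
have c2 : cabs (s (p + 2) n - Kp (p + 2) z w) @[n --> \oo] --> 0 := Kp_cvg p2 zw.
move: (Kp p z w) (Kp (p + 2) z w) c1 c2 => K1 K2 c1 c2.
have c0 : cabs (s p n - K1) + cabs (s (p + 2) n - K2) @[n --> \oo] --> 0.
  by rewrite -[X in _ --> X](addr0 0); exact: cvgD.
apply: (squeeze_cvgr _ (cvg_cst 0) c0); apply: nearW => n; rewrite cabs_ge0 /=.
apply: le_trans (cabsD _ _); rewrite le_eqVlt; apply/orP; left; apply/eqP.
congr cabs; rewrite addrACA -opprD; congr (_ - _); rewrite -big_split.
by apply: eq_bigr => k _ /=; rewrite -mulrDl -(rmorphD (real_complex R)).
Qed.

Lemma kcoef_sum_bounded (r : R) : 0 <= r -> r < 1 ->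
  exists B, forall n, \sum_(0 <= k < n) a k * r ^+ k <= B.
Proof.
move=> r0 r1; have [B1 h1] := powR_sum_bounded p0 r0 r1.
have p2 : 0 < p + 2 by rewrite addr_gt0.
have [B2 h2] := powR_sum_bounded p2 r0 r1.
exists (B1 + B2) => n; apply: le_trans (lerD (h1 n) (h2 n)).
by rewrite -big_split /=; apply: ler_sum => k _; rewrite -mulrDl.
Qed.

Lemma kernel_tail n : exists2 B, 0 <= B & forall z w, cabs (z * w^*) <= 2^-1 ->
  cabs (K z w - \sum_(0 <= k < n) (a k)%:C * (z * w^*) ^+ k) <= B * cabs (z * w^*) ^+ n.
Proof.
have h0 : 0 <= 2^-1 :> R by rewrite invr_ge0.
have h1 : 2^-1 < 1 :> R by rewrite invf_lt1 ?ltr1n.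
have [B hB] := kcoef_sum_bounded h0 h1.
have B0 : 0 <= B by have := hB 0%N; rewrite big_geq.
(* For |t| <= 1/2 and k >= n one has |t|^k <= 2^n |t|^n 2^(-k), so the tail is controlled by the
   series of a_k 2^(-k). *)
exists (2 ^+ n * B) => [|z w]; first by rewrite mulr_ge0 ?exprn_ge0.
set t := z * w^* => t2.
have t1 : cabs t < 1 := le_lt_trans t2 h1.
pose s N := \sum_(0 <= k < N) (a k)%:C * t ^+ k.
have c1 : cabs (s N - K z w) + 2 ^+ n * B * cabs t ^+ n @[N --> \oo] --> 2 ^+ n * B * cabs t ^+ n.
  by rewrite -[X in _ --> X]add0r; apply: cvgD; [exact: kernel_cvg | exact: cvg_cst].
apply: (cvgr_to_ge c1); exists n => // N /= nN.
rewrite -(subrKA (s N)) (le_trans (cabsD _ _))// lerD//; first by rewrite /cabs distrC.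
rewrite /s (big_cat_nat (leq0n n) nN) /= addrAC subrr add0r.
apply: le_trans (cabs_sum _ _) _.
apply: (@le_trans _ _ (\sum_(n <= k < N) (2 ^+ n * cabs t ^+ n) * (a k * 2^-1 ^+ k))).
  rewrite big_nat [leRHS]big_nat; apply: ler_sum => k /andP[nk _].
  rewrite cabsM cabs_real cabsX ger0_norm ?(ltW (kcoef_gt0 _ _))// mulrCA.
  rewrite ler_wpM2l ?(ltW (kcoef_gt0 _ _))//.
  rewrite -(subnK nk); move: (k - n)%N => d; rewrite !exprD.
  have -> : 2 ^+ n * cabs t ^+ n * (2^-1 ^+ d * 2^-1 ^+ n) = 2^-1 ^+ d * cabs t ^+ n.
    have : 2 ^+ n * 2^-1 ^+ n = 1 :> R by rewrite -exprMn mulfV ?expr1n.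
    by move=> h; rewrite [2^-1 ^+ d * _]mulrC mulrACA h mul1r mulrC.
  by rewrite ler_wpM2r ?exprn_ge0 ?cabs_ge0// lerXn2r ?nnegrE ?cabs_ge0.
rewrite -mulr_sumr mulrAC ler_wpM2r ?exprn_ge0 ?cabs_ge0// ler_wpM2l ?exprn_ge0//.
apply: le_trans (hB N); rewrite (big_cat_nat (leq0n n) nN) /= lerDr sumr_ge0// => k _.
by rewrite mulr_ge0 ?exprn_ge0// ltW// kcoef_gt0.
Qed.

End KernelSeries.

(** * The monomials as an orthogonal basis *)

Section DiagonalSpace.
Variables (R : realType) (p : R).
Hypothesis p0 : 0 < p.
Notation C := R[i].
Variable H : rkhs (fun z w : C => Kp p z w + Kp (p + 2) z w).
Notation a := (kcoef p).
Notation K z w := (Kp p z w + Kp (p + 2) z w).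
Notation ip := (inner H).

Let a0 n : 0 < a n := kcoef_gt0 p n.

Lemma unit_discE (z : C) : unit_disc z <-> cabs z < 1.
Proof. by rewrite /unit_disc /= -cabsE (ltcR _ 1). Qed.

Definition monomial n (e : H) := forall z, unit_disc z -> rkhs_eval e z = z ^+ n.

Lemma monomial_unique n e e' : monomial n e -> monomial n e' -> e = e'.
Proof. by move=> he he'; apply: rkhs_separated => z zD; rewrite he// he'. Qed.

(** The reproducing property supplies kernel functions only, so membership of z^n in [H] is proved
    by induction together with its norm and its orthogonality to lower powers. *)
Let good n (e : H) := [/\ monomial n e, ip e e = (moment p n)%:C &
  forall m e', (m < n)%N -> monomial m e' -> ip e e' = 0].

(* The monomial z ^ n is the limit as r -> 0 of
   (K(., r) - sum_(m < n) a_m r^m z^m) / (a_n r^n). *)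
Section Limit.
Variables (n : nat) (E : nat -> H).
Hypothesis Egood : forall m, (m < n)%N -> good m (E m).

Let EE m l : (m < n)%N -> (l < n)%N -> ip (E m) (E l) = ((m == l)%:R * moment p m)%:C.
Proof.
move=> mn ln; have [Em nm om] := Egood mn; have [El nl ol] := Egood ln.
have [<-|ml] := eqVneq; first by rewrite mul1r.
rewrite mulr0n mul0r; move: ml; rewrite neq_ltn => /orP[ml|lm]; last exact: om lm El.
by rewrite innerC (ol _ _ ml Em) rmorph0.
Qed.

Let r j : R := 2^-1 ^+ j.+1.
Let r0 j : 0 < r j. Proof. by rewrite exprn_gt0// invr_gt0. Qed.
Let r_le j : r j <= 2^-1.
Proof. by rewrite /r exprS ger_pMr ?invr_gt0// exprn_ile1 ?invr_ge0// invf_le1 ?ler1n. Qed.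
Let r_disc j : unit_disc (r j)%:C.
Proof.
rewrite unit_discE cabs_real gtr0_norm// (le_lt_trans (r_le j))//.
by rewrite invf_lt1 ?ltr1n.
Qed.
Let r_cvg : r j @[j --> \oo] --> 0.
Proof.
rewrite (cvg_shiftS (fun j => 2^-1 ^+ j : R)); apply: cvg_expr.
by rewrite ger0_norm ?invr_ge0// invf_lt1 ?ltr1n.
Qed.

Let ker j := projT1 (cid (rkhs_reproducing H (r_disc j))).
Let kerE j z : unit_disc z -> rkhs_eval (ker j) z = K z (r j)%:C.
Proof. by rewrite /ker; case: cid => k /= [+ _]; apply. Qed.
Let kerP j f : rkhs_eval f (r j)%:C = ip f (ker j).
Proof. by rewrite /ker; case: cid => k /= [_]. Qed.

Let c j := a n * r j ^+ n.
Let c0 j : 0 < c j. Proof. by rewrite mulr_gt0// exprn_gt0. Qed.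

Let g j := ((c j)^-1)%:C *: (ker j - \sum_(0 <= m < n) (a m * r j ^+ m)%:C *: E m).

Let g_inner j f : ip (g j) f = ((c j)^-1)%:C *
  (ip (ker j) f - \sum_(0 <= m < n) (a m * r j ^+ m)%:C * ip (E m) f).
Proof.
rewrite innerZl innerBl inner_suml; congr (_ * (_ - _)).
by apply: eq_bigr => m _; rewrite innerZl.
Qed.

Let rC j m : (r j ^+ m)%:C = (r j)%:C ^+ m :> C.
Proof. by rewrite (rmorphXn (real_complex R)). Qed.

Let ker_mono j m e : monomial m e -> ip (ker j) e = (r j ^+ m)%:C.
Proof. by move=> me; rewrite innerC -kerP me// -rC conjC_real. Qed.

Let g_orth j m : (m < n)%N -> ip (g j) (E m) = 0.
Proof.
move=> mn; have [Em _ _] := Egood mn.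
rewrite g_inner (ker_mono j Em) (bigD1_seq m) ?mem_index_iota ?iota_uniq//=.
rewrite EE// eqxx mul1r -(rmorphM (real_complex R)) mulrAC mulfV ?gt_eqF// mul1r.
rewrite big_nat_cond big1 ?addr0 ?subrr ?mulr0// => l /andP[/andP[_ ln] lm].
by rewrite EE// (negbTE lm) mul0r mulr0.
Qed.

(* Evaluation of g j at z is the Taylor remainder of the kernel at z r j,
   divided by a n r j ^ n. *)
Let g_eval j z (f : H) : cabs (z * (r j)%:C) <= 2^-1 ->
  ip (ker j) f = K z (r j)%:C -> (forall m, (m < n)%N -> ip (E m) f = z ^+ m) ->
  ip (g j) f = ((c j)^-1)%:C *
    (K z (r j)%:C - \sum_(0 <= m < n) (a m)%:C * (z * (r j)%:C^*) ^+ m).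
Proof.
move=> zr kf Ef; rewrite g_inner kf; congr (_ * (_ - _)).
rewrite big_nat [RHS]big_nat; apply: eq_bigr => m /andP[_ mn].
rewrite Ef// conjC_real exprMn (rmorphM (real_complex R)) -rC; ring.
Qed.

Let g_lim : exists2 B, 0 <= B & forall j z f, cabs (z * (r j)%:C) <= 2^-1 ->
  ip (ker j) f = K z (r j)%:C -> (forall m, (m < n)%N -> ip (E m) f = z ^+ m) ->
  cabs (ip (g j) f - z ^+ n) <= B * cabs z ^+ n.+1 * r j.
Proof.
have [B B0 hB] := kernel_tail p0 n.+1.
exists (B / a n) => [|j z f zr kf Ef]; first by rewrite divr_ge0// ltW.
rewrite (g_eval zr kf Ef).
have zr' : cabs (z * (r j)%:C^*) <= 2^-1 by rewrite conjC_real.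
have := hB z (r j)%:C zr'; rewrite big_nat_recr//= conjC_real.
set S := \sum_(0 <= m < n) _; set kz := K z _.
have cC : (c j)%:C != 0 :> C by rewrite (fmorph_eq0 (real_complex R)) gt_eqF.
have -> : ((c j)^-1)%:C * (kz - S) - z ^+ n =
    ((c j)^-1)%:C * (kz - (S + (a n)%:C * (z * (r j)%:C) ^+ n)).
  have h : ((c j)^-1)%:C * ((a n)%:C * (r j)%:C ^+ n) = 1 :> C.
    by rewrite -rC -!(rmorphM (real_complex R)) mulVf ?gt_eqF.
  transitivity (((c j)^-1)%:C * (kz - S) - z ^+ n * (((c j)^-1)%:C * ((a n)%:C * (r j)%:C ^+ n))).
    by rewrite h mulr1.
  by rewrite exprMn; ring.
move=> h; rewrite cabsM cabs_real ger0_norm ?invr_ge0 ?(ltW (c0 j))//.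
rewrite ler_pdivrMl//; apply: (le_trans h).
rewrite cabsM cabs_real (ger0_norm (ltW (r0 j))) exprMn /c.
rewrite le_eqVlt; apply/orP; left; apply/eqP.
by rewrite [r j ^+ n.+1]exprS; field; rewrite gt_eqF.
Qed.

Lemma monomial_step : exists e, good n e.
Proof.
have [B B0 hB] := g_lim.
have rr i j : cabs ((r i)%:C * (r j)%:C) <= 2^-1.
  rewrite cabsM !cabs_real !gtr0_norm// -[leRHS]mulr1 ler_pM ?(ltW (r0 _))//.
  by rewrite (le_trans (r_le j))// invf_le1 ?ler1n.
(* All <g i, g j> approach the same number with error of order r_i r_j. In the expansion of |g i - g
   j|^2 that number cancels, which makes [g] a Cauchy sequence. *)
have gg i j : cabs (ip (g i) (g j) - (moment p n)%:C) <= B / a n * (r i * r j).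
  have -> : ip (g i) (g j) = ((c i)^-1)%:C * (ip (g j) (ker i))^*.
    rewrite g_inner big_nat big1 ?subr0 -?innerC// => m /andP[_ mn].
    by rewrite innerC g_orth// rmorph0 mulr0.
  have h := hB j (r i)%:C (ker i) (rr i j) _ _.
  have {}h : cabs (ip (g j) (ker i) - (r i)%:C ^+ n) <= B * r i ^+ n.+1 * r j.
    rewrite -[X in B * X ^+ _](gtr0_norm (r0 i)) -cabs_real; apply: h.
      by rewrite -kerP kerE.
    by move=> m mn; have [Em _ _] := Egood mn; rewrite -kerP Em.
  have mE : (moment p n)%:C = ((c i)^-1)%:C * ((r i)%:C ^+ n)^* :> C.
    rewrite -rC conjC_real -(rmorphM (real_complex R)) /moment /c invfM.
    by rewrite divfK// gt_eqF// exprn_gt0.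
  rewrite mE -mulrBr -rmorphB cabsM cabs_conj cabs_real ger0_norm ?invr_ge0 ?(ltW (c0 i))//.
  rewrite ler_pdivrMl//; apply: (le_trans h).
  rewrite le_eqVlt; apply/orP; left; apply/eqP.
  by rewrite /c [r i ^+ n.+1]exprS; field; rewrite gt_eqF.
pose D := B / a n.
have D0 : 0 <= D by rewrite divr_ge0// ltW.
have [e ge] : exists e, hnorm (g j - e) @[j --> \oo] --> 0.
  apply: (@hilbert_complete R H g (fun j => 2 * Num.sqrt D * r j)).
    by rewrite -[X in _ --> X](mulr0 (2 * Num.sqrt D)); apply: cvgMl_tmp.
  move=> i j ji; have rij : r i <= r j.
    by rewrite /r ler_wiXn2l ?invr_ge0// invf_le1 ?ler1n.
  rewrite -(ler_pXn2r (n := 2)) ?nnegrE ?hnorm_ge0 ?mulr_ge0 ?sqrtr_ge0 ?(ltW (r0 j))//.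
  rewrite !exprMn sqr_sqrtr// hnorm_sqr innerBl !innerBr.
  set m : C := (moment p n)%:C.
  rewrite (_ : _ - _ = (ip (g i) (g i) - m) - (ip (g i) (g j) - m)
    - ((ip (g j) (g i) - m) - (ip (g j) (g j) - m))); last by ring.
  apply: le_trans (ler_norm _) _; apply: le_trans (ler_cabs_Re _) _.
  have cabsB (x y : C) : cabs (x - y) <= cabs x + cabs y.
    by apply: le_trans (cabsD _ _) _; rewrite cabsN.
  apply: le_trans (cabsB _ _) _.
  apply: le_trans (lerD (cabsB _ _) (cabsB _ _)) _.
  apply: le_trans (lerD (lerD (gg i i) (gg i j)) (lerD (gg j i) (gg j j))) _.
  have h : r i * r i + r i * r j + (r j * r i + r j * r j) <= 2 ^+ 2 * r j ^+ 2.
    by move: (r0 i) (r0 j) rij; move: (r i) (r j) => x y; nra.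
  by have := ler_wpM2l D0 h; rewrite !mulrDr [leRHS]mulrCA [leRHS]mulrA.
exists e.
have zr (z : C) j : unit_disc z -> cabs (z * (r j)%:C) <= 2^-1.
  rewrite unit_discE cabsM cabs_real gtr0_norm// => z1.
  by rewrite (le_trans _ (r_le j))// ler_piMl ?(ltW (r0 j))// ltW.
have e_mono : monomial n e.
  move=> z zD; have [kz [kzE kzP]] := rkhs_reproducing H zD.
  rewrite kzP; apply: (climit_unique (inner_lim kz ge)).
  have c1 : B * cabs z ^+ n.+1 * r j @[j --> \oo] --> 0.
    by rewrite -[X in _ --> X](mulr0 (B * cabs z ^+ n.+1)); apply: cvgMl_tmp.
  apply: (squeeze_cvgr _ (cvg_cst 0) c1); apply: nearW => j.
  rewrite cabs_ge0 hB//; first exact: zr.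
    by rewrite -kzP kerE.
  by move=> m mn; have [Em _ _] := Egood mn; rewrite -kzP Em.
have e_orth m : (m < n)%N -> ip e (E m) = 0.
  move=> mn; apply: (climit_unique (inner_lim (E m) ge)).
  under eq_fun do rewrite g_orth// subrr (cabs_real 0) normr0.
  exact: cvg_cst.
split=> //; last first.
  by move=> m e' mn me'; have [Em _ _] := Egood mn; rewrite (monomial_unique me' Em) e_orth.
(* <g j, e> is the conjugate of e (r j) = r_j^n divided by a_n r_j^n, so it equals the moment for
   every j. *)
apply: (climit_unique (inner_lim e ge)).
under eq_fun.
  move=> j; rewrite g_inner (ker_mono j e_mono) big_nat big1; last first.
    by move=> m /andP[_ mn]; rewrite innerC e_orth// rmorph0 mulr0.
  rewrite subr0 -(rmorphM (real_complex R)) /c invfM divfK ?gt_eqF ?exprn_gt0//.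
  rewrite subrr (cabs_real 0) normr0.
  over.
exact: cvg_cst.
Qed.
End Limit.

Lemma monomial_exists n : exists e, good n e.
Proof.
elim/ltn_ind: n => n IH.
have choose m : exists e, (m < n)%N -> good m e.
  by have [/IH[e]|_] := ltnP m n; [exists e | exists 0].
by apply: (@monomial_step n (fun m => projT1 (cid (choose m)))) => m; case: cid.
Qed.

Definition mono n : H := projT1 (cid (monomial_exists n)).

Lemma monoE n z : unit_disc z -> rkhs_eval (mono n) z = z ^+ n.
Proof. by rewrite /mono; case: cid => e /= [+ _ _]; apply. Qed.

Lemma mono_inner m n : ip (mono m) (mono n) = ((m == n)%:R * moment p m)%:C.
Proof.
have [<-|mn] := eqVneq.
  by rewrite mul1r /mono; case: cid => e /= [].
wlog lt_nm : m n mn / (n < m)%N => [H'|].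
  move: (mn); rewrite neq_ltn => /orP[lt|lt]; last exact: H'.
  by rewrite innerC H' 1?eq_sym// !mulr0n !mul0r rmorph0.
rewrite mulr0n mul0r {1}/mono; case: cid => e /= [_ _ h].
by apply: h lt_nm _ => z; exact: monoE.
Qed.

Definition mono_basis n : H := (Num.sqrt (a n))%:C *: mono n.

Lemma mono_basis_onb : onb mono_basis.
Proof.
split.
  move=> i j; rewrite innerZl innerZr conjC_real mono_inner -!(rmorphM (real_complex R)).
  have [<-|_] := eqVneq; last by rewrite mulr0n mul0r !mulr0.
  by rewrite mul1r mulrA -expr2 sqr_sqrtr ?(ltW (a0 i))// mulfV// gt_eqF.
move=> f f0; apply: rkhs_separated => z zD.
have [kz [kzE kzP]] := rkhs_reproducing H zD.
rewrite !kzP inner0l.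
have fe i : ip f (mono i) = 0.
  have := f0 i; rewrite innerZr conjC_real => /eqP; rewrite mulf_eq0.
  rewrite (fmorph_eq0 (real_complex R)) sqrtr_eq0 leNgt a0 /= => /eqP //.
(* Taylor sums of the reproducing vector [kz]. Both <S N, kz> and |S N|^2 equal s N, so |S N - kz|^2
   = K z z - s N tends to 0 and [kz] lies in the closed span of the monomials. *)
pose S N := \sum_(0 <= m < N) ((a m)%:C * (z ^+ m)^*) *: mono m.
have Sf N : ip (S N) f = 0.
  by rewrite inner_suml big1// => m _; rewrite innerZl innerC fe rmorph0 mulr0.
pose s N := \sum_(0 <= m < N) (a m)%:C * (z * z^*) ^+ m.
have Skz N : ip (S N) kz = s N.
  rewrite inner_suml; apply: eq_bigr => m _.
  by rewrite innerZl -kzP monoE// exprMn rmorphXn /=; ring.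
have SS N : ip (S N) (S N) = s N.
  rewrite inner_suml big_nat [RHS]big_nat; apply: eq_bigr => m /andP[_ mN].
  rewrite innerZl inner_sumr (bigD1_seq m) ?mem_index_iota ?iota_uniq//=.
  rewrite innerZr mono_inner eqxx mul1r big1 ?addr0; last first.
    by move=> l lm; rewrite innerZr mono_inner eq_sym (negbTE lm) mulr0n mul0r mulr0.
  have h : (a m)%:C * (moment p m)%:C = 1 :> C.
    by rewrite -(rmorphM (real_complex R)) mulfV// gt_eqF.
  rewrite rmorphM /= conjCK conjC_real exprMn rmorphXn /=.
  transitivity ((a m)%:C * (z ^+ m * z^* ^+ m) *
    ((a m)%:C * (moment p m)%:C)); last by rewrite h mulr1.
  by ring.
have zz : cabs (z * z^*) < 1.
  have : cabs z < 1 by rewrite -unit_discE.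
  have := cabs_ge0 z; rewrite cabsM cabs_conj.
  by move: (cabs z) => x; nra.
have cS : hnorm (S N - kz) @[N --> \oo] --> 0.
  have c1 : Num.sqrt (cabs (s N - K z z)) @[N --> \oo] --> 0.
    rewrite -[X in _ --> X]sqrtr0; apply: continuous_cvg; first exact: sqrt_continuous.
    exact: kernel_cvg.
  apply: (squeeze_cvgr _ (cvg_cst 0) c1); apply: nearW => N; rewrite hnorm_ge0 /=.
  rewrite -[leLHS]ger0_norm ?hnorm_ge0// -sqrtr_sqr ler_wsqrtr//.
  rewrite hnorm_sqr innerBl !innerBr SS Skz subrr add0r (innerC (S N) kz) Skz -kzP kzE//.
  rewrite (_ : complex.Re _ = - complex.Re (s N - K z z)); last first.
    by case: (s N) (K z z) => ? ? [? ?] /=; ring.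
  by rewrite (le_trans (ler_norm _))// normrN ler_cabs_Re.
rewrite innerC (_ : ip kz f = 0) ?rmorph0//.
apply: (climit_unique (inner_lim f cS)).
under eq_fun do rewrite Sf subrr (cabs_real 0) normr0.
exact: cvg_cst.
Qed.

End DiagonalSpace.

(** * Multiplication by z as a weighted shift *)

Section ShiftOnDiagonalSpace.
Variables (R : realType) (p : R).
Hypothesis p0 : 0 < p.
Variable H : rkhs (fun z w : R[i] => Kp p z w + Kp (p + 2) z w).
Notation u := (mono_basis p0 H).
Notation weight n := (Num.sqrt (moment p n.+1 / moment p n)).

Lemma kcoef_ge1 n : 1 <= kcoef p n.
Proof.
have x1 : 1 <= n.+1%:R :> R by rewrite ler1n.
have h (q : R) : 0 < q -> 1 <= n.+1%:R `^ q.
  by move=> q0; rewrite -[leLHS](powRr0 n.+1%:R) ler_powR// ltW.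
have p2 : 0 < p + 2 by rewrite addr_gt0.
by rewrite /kcoef (le_trans (h p p0))// lerDl powR_ge0.
Qed.

Lemma moment_le1 n : moment p n <= 1.
Proof. by rewrite invf_le1 ?kcoef_gt0// kcoef_ge1. Qed.

Lemma moment_decr n : moment p n.+1 <= moment p n.
Proof.
rewrite lef_pV2 ?posrE ?kcoef_gt0// /kcoef lerD//; apply: ge0_ler_powR;
by rewrite ?nnegrE ?ler0n ?ler_nat ?addr_ge0 ?(ltW p0).
Qed.

Lemma shift_exists : exists M : {linear H -> H},
  hbounded M 1 /\ forall n, M (u n) = (weight n)%:C *: u n.+1.
Proof.
have uB := mono_basis_onb p0 H.
apply: (onb_operator uB) => // [i j ij|i].
  by rewrite innerZl innerZr uB.1 eqSS (negbTE ij) !mulr0.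
rewrite expr1n hnormZ (onb_norm uB) mulr1 cabs_real ger0_norm ?sqrtr_ge0//.
rewrite sqr_sqrtr ?divr_ge0 ?(ltW (moment_gt0 _ _))//.
by rewrite ler_pdivrMr ?moment_gt0// mul1r moment_decr.
Qed.

Variable M : {linear H -> H}.
Hypotheses (M1 : hbounded M 1) (Mu : forall n, M (u n) = (weight n)%:C *: u n.+1).

Lemma shift_mono n : M (mono p0 H n) = mono p0 H n.+1.
Proof.
have aE k : mono p0 H k = (Num.sqrt (moment p k))%:C *: u k.
  rewrite /mono_basis scalerA -(rmorphM (real_complex R)) -sqrtrM ?(ltW (moment_gt0 _ _))//.
  by rewrite mulVf ?gt_eqF ?kcoef_gt0// sqrtr1 scale1r.
rewrite !aE linearZ_LR Mu scalerA -(rmorphM (real_complex R)) -sqrtrM ?(ltW (moment_gt0 _ _))//.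
by rewrite mulrC divfK// gt_eqF// moment_gt0.
Qed.

(** At a fixed z both sides are bounded functionals of f, hence it is enough to compare them on
    monomials. *)
Lemma shift_mul_z : is_mul_z M.
Proof.
move=> f z zD; have [kz [kzE kzP]] := rkhs_reproducing H zD.
rewrite !kzP; apply/eqP; rewrite -subr_eq0; apply/eqP.
apply: (@onb_functional_ext R H u (mono_basis_onb p0 H)
  (fun f => inner H (M f) kz - z * inner H f kz) (hnorm kz + cabs z * hnorm kz)).
- by move=> a g h; rewrite (linearD M) (linearZ_LR M) !innerDl !innerZl; ring.
- move=> g; apply: le_trans (cabsD _ _) _; rewrite mulrDl; apply: lerD.
    apply: le_trans (inner_CauchySchwarz _ _) _.
    by rewrite mulrC ler_wpM2l ?hnorm_ge0// (le_trans (M1 g))// mul1r.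
  rewrite cabsN cabsM -mulrA ler_wpM2l ?cabs_ge0// mulrC.
  exact: inner_CauchySchwarz.
- move=> n; rewrite /mono_basis (linearZ_LR M) shift_mono !innerZl -!kzP.
  by rewrite !monoE// exprS; ring.
Qed.

Lemma shift_subnormal_iff : subnormal M <-> 1 <= p.
Proof.
split=> [subM|p1].
  rewrite leNgt; apply/negP => p1.
  have iterM n : iter n M (mono p0 H 0%N) = mono p0 H n.
    by elim: n => //= n ->; rewrite shift_mono.
  have normM n : hnorm (iter n M (mono p0 H 0%N)) ^+ 2 = moment p n.
    by rewrite iterM hnorm_sqr mono_inner eqxx mul1r.
  apply: (moment_fdiff_ge0_absurd p0 p1) => n.
  rewrite -(eq_fdiff _ _ normM); apply: (subnormal_fdiff_ge0 subM (B := 1)) => k.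
  rewrite -(ler_pXn2r (n := 2)) ?nnegrE ?hnorm_ge0// normM expr1n.
  exact: moment_le1.
have mu_bounded n : `|sym_moment p n| <= 1.
  rewrite /sym_moment; case: odd; first by rewrite normr0.
  by rewrite ger0_norm ?moment_le1// ltW// moment_gt0.
have mu_psd c N := sym_moment_psd c N p1.
have mu_odd n : odd n -> sym_moment p n = 0 by rewrite /sym_moment => ->.
have mu0 : 0 < sym_moment p 0 by exact: moment_gt0.
apply: (@jacobi_subnormal R H u (mono_basis_onb p0 H) (jacobi_weight (sym_moment p))
  _ _ (jacobi_entry (sym_moment p)) _ _ M (moment p)).
- by move=> n; exact: jacobi_weight_ge0.
- by move=> n; apply: (jacobi_weight_le1 mu_psd mu_bounded).
- by move=> k; apply: jacobi_entry_row0.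
- move=> n [|k]; rewrite /tri.
    by rewrite addr0; apply: jacobi_entryS0.
  by apply: jacobi_entrySS.
- by move=> n; exact: moment_gt0.
- by move=> n; rewrite jacobi_entry_col0// /sym_moment odd_double doubleK.
- exact: hbounded_bounded M1.
- exact: Mu.
Qed.

End ShiftOnDiagonalSpace.

Theorem theorem2p16 (R : realType) (p : R) (p_gt0 : 0 < p)
    (H : rkhs (fun z w : R[i] => Kp p z w + Kp (p + 2) z w)) :
  exists Mz : {linear H -> H},
    [/\ is_mul_z Mz, bounded_operator Mz & subnormal Mz <-> 1 <= p].
Proof.
have [M [M1 Mu]] := shift_exists p_gt0 H.
exists M; split; first exact: shift_mul_z M1 Mu.
  exact: hbounded_bounded M1.
exact: shift_subnormal_iff M1 Mu.
Qed.
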